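(* Let $p$ be an odd prime and let $c$ be an integer. Then \[ \sum_{\substack{r\in\mathbb{Z},\ |r|<2\sqrt p,\\ r\equiv c\pmod 4}}H(4p-r^2) =\begin{cases} \frac{p+1}{3}, & c\equiv\pm 1\pmod 4,\\ \frac{5p-7}{6}, & c\equiv p+1\pmod 4,\\ \frac{p+1}{2}, & c\equiv p-1\pmod 4. \end{cases} \]
   Context: $H(N)$ denotes the Hurwitz class number: for an integer $N\ge 0$, $H(0)=-1/12$; $H(N)=0$ if $N\equiv 1,2\pmod 4$; otherwise $H(N)$ is the number of $\mathrm{SL}_2(\mathbb{Z})$-equivalence classes of (not necessarily primitive) positive definite binary quadratic forms of discriminant $-N$, where classes containing a multiple of $x^2+y^2$ are counted with weight $1/2$ and classes containing a multiple of $x^2+xy+y^2$ are counted with weight $1/3$. The sum runs over all integers $r$ (positive, negative and zero) satisfying the stated conditions. *)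

(* Defs.v *)
From Stdlib Require Import ClassicalEpsilon.
From mathcomp Require Import all_boot all_order all_algebra.
Set Implicit Arguments. Unset Strict Implicit. Unset Printing Implicit Defensive.
Import Order.TTheory GRing.Theory Num.Theory.
Local Open Scope ring_scope.

(* A binary quadratic form a x^2 + b x y + c y^2 is the triple (a, b, c). *)
Definition form := (int * int * int)%type.
Definition fa (f : form) : int := f.1.1.
Definition fb (f : form) : int := f.1.2.
Definition fc (f : form) : int := f.2.

Definition disc (f : form) : int := fb f ^+ 2 - 4 * fa f * fc f.

Definition pos_def (f : form) : Prop := 0 < fa f /\ disc f < 0.

(* action of [[al, be], [ga, de]] in SL2(Z): f(al x + be y, ga x + de y) *)
Definition act (f : form) (al be ga de : int) : form :=
  (fa f * al ^+ 2 + fb f * al * ga + fc f * ga ^+ 2,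
   2 * fa f * al * be + fb f * (al * de + be * ga) + 2 * fc f * ga * de,
   fa f * be ^+ 2 + fb f * be * de + fc f * de ^+ 2).

Definition sl2_equiv (f g : form) : Prop :=
  exists al be ga de : int, al * de - be * ga = 1 /\ act f al be ga de = g.

Definition rep_system (N : nat) (S : seq form) : Prop :=
  (forall f, f \in S -> pos_def f /\ disc f = - (N%:Z)) /\
  (forall i j : nat, (i < size S)%N -> (j < size S)%N -> i <> j ->
      ~ sl2_equiv (nth (0,0,0) S i) (nth (0,0,0) S j)) /\
  (forall f, pos_def f -> disc f = - (N%:Z) -> exists2 g, g \in S & sl2_equiv f g).

Definition class_weight (f : form) : rat :=
  if excluded_middle_informative (exists k : int, sl2_equiv f (k, 0, k)) then 1 / 2
  else if excluded_middle_informative (exists k : int, sl2_equiv f (k, k, k)) then 1 / 3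
  else 1.

Definition hurwitz (N : nat) : rat :=
  if N == 0%N then - (1 / 12)
  else match excluded_middle_informative (exists S, rep_system N S) with
       | left h => \sum_(f <- proj1_sig (constructive_indefinite_description _ h))
                     class_weight f
       | right _ => 0
       end.

(* Main.v *)
(** A reduced form of discriminant [-N] corresponds to a triple [a, b, c >= 0] of equal parity with
[a b + b c + c a = N], so [24 H(N)] is a weighted count of triples and the sum of the class numbers
counts the solutions of [r^2 + a b + b c + c a = 4 p].  Half-sums of the variables turn these into
the solutions of [x y + a c = p] in positive integers, weighted by step functions of linear forms.
As in Liouville's elementary method, these weights are combinations of differences [F - F o g], for
bijections [g] between parts of the solution set, up to terms supported on [x = c]; since [p] is
prime, [x = c] forces [x = c = 1], and these terms can be summed directly.  In the class [p - 1],
exactly one of [a, b, c] differs from the other two modulo 4, and by symmetry one may take [b]. *)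
From Stdlib Require Import ZArith Lia ClassicalEpsilon.
From mathcomp Require Import all_boot all_order all_algebra zify ssrZ ring lra.
Require Import Defs.
Set Implicit Arguments. Unset Strict Implicit. Unset Printing Implicit Defensive.
Import Order.TTheory GRing.Theory Num.Theory.
Local Open Scope ring_scope.

Delimit Scope Z_scope with zz.
Local Arguments Z.add : simpl never.
Local Arguments Z.mul : simpl never.
Local Arguments Z.sub : simpl never.
Local Arguments Z.modulo : simpl never.

(** * Sums over the solutions of [x * y + a * c = n] *)

(** The bijections are linear substitutions preserving [x y + a c], each defined on one side of a
    wall [x = a], [x = c] or [y = a]. They are applied to solutions of fixed parity type, and parity
    leaves exactly one wall with points on it: [x = c] when only [a] is even. This is where the
    identities need a correction. All the functions involved are constant on cones cut out by
    integral linear forms, and depend besides only on residues modulo 4. An identity between them is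
    therefore a finite statement, but it has too many cones to treat by hand; a decision procedure
    proved sound evaluates it, so nothing has to be known about how the coefficients arose. Parity
    alone settles the total over odd [r] and the total over even [r]; the symmetry of [r] and [-r]
    halves the former. Separating the two even classes is the step that needs residues modulo 4.
    Only the class [p - 1] is treated so; the class [p + 1] follows by subtraction. *)

Lemma big_reindex_mem (R : nmodType) (I J : eqType) (s : seq I) (t : seq J)
    (h : I -> J) (F : J -> R) :
  uniq s -> uniq t -> {in s &, injective h} -> {in s, forall i, h i \in t} ->
  {in t, forall j, exists2 i, i \in s & j = h i} ->
  \sum_(j <- t) F j = \sum_(i <- s) F (h i).
Proof.
move=> us ut hinj hst hts; rewrite -(big_map h xpredT F).
apply: perm_big; apply: uniq_perm => //; first by rewrite map_inj_in_uniq.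
move=> j; apply/idP/mapP => [/hts [i si ->]|[i si ->]]; first by exists i.
exact: hst.
Qed.

Lemma big_reindex_cond (R : nmodType) (I J : eqType) (s : seq I) (t : seq J)
    (P : pred I) (Q : pred J) (h : I -> J) (g : J -> I) (F : J -> R) :
  uniq s -> uniq t ->
  {in s, forall i, P i -> [/\ h i \in t, Q (h i) & g (h i) = i]} ->
  {in t, forall j, Q j -> [/\ g j \in s, P (g j) & h (g j) = j]} ->
  \sum_(j <- t | Q j) F j = \sum_(i <- s | P i) F (h i).
Proof.
move=> us ut hP gQ; rewrite -big_filter -[RHS]big_filter.
apply: big_reindex_mem; rewrite ?filter_uniq //.
- move=> i j; rewrite !mem_filter => /andP[Pi si] /andP[Pj sj] eq_h.
  by have [_ _ <-] := hP i si Pi; have [_ _ <-] := hP j sj Pj; rewrite eq_h.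
- move=> i; rewrite !mem_filter => /andP[Pi si].
  by have [-> ->] := hP i si Pi.
- move=> j; rewrite !mem_filter => /andP[Qj tj].
  have [gs Pg hg] := gQ j tj Qj.
  by exists (g j); rewrite ?mem_filter ?Pg.
Qed.

Definition zrange (n : nat) : seq int := [seq i%:Z | i <- iota 0 n.+1].

Lemma mem_zrange n (x : int) : (x \in zrange n) = (0 <= x <= n%:Z).
Proof.
apply/mapP/idP => [[i]|/andP[x0 xn]]; first by rewrite mem_iota => ? ->; lia.
by exists `|x|%N; rewrite ?mem_iota; lia.
Qed.

Lemma uniq_zrange n : uniq (zrange n).
Proof. by rewrite map_inj_uniq ?iota_uniq // => i j []. Qed.

Definition box (n : nat) : seq (int * int * int * int) :=
  [seq (u, t) | u <- [seq (v, z) | v <- [seq (x, y) | x <- zrange n, y <- zrange n],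
                                   z <- zrange n], t <- zrange n].

Lemma uniq_box n : uniq (box n).
Proof.
have uallp (S T : eqType) (s : seq S) (t : seq T) : uniq s -> uniq t ->
    uniq [seq (u, v) | u <- s, v <- t].
  by move=> us ut; apply: allpairs_uniq => // -[? ?] [? ?] _ _ [-> ->].
by do 3![apply/uallp; rewrite ?uniq_zrange //].
Qed.

Lemma mem_box n x y a c :
  ((x, y, a, c) \in box n) =
  [&& 0 <= x <= n%:Z, 0 <= y <= n%:Z, 0 <= a <= n%:Z & 0 <= c <= n%:Z].
Proof.
rewrite -!mem_zrange; apply/allpairsP/and4P => [|[xn yn an cn]].
  case=> -[u t] [Hu Ht [eu ->]]; have /allpairsP [[v z] [Hv Hz ev]] := Hu.
  have /allpairsP [[x' y'] [Hx Hy evx]] := Hv.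
  move: eu ev evx Hx Hy Hz Ht => /= <- /= -[<- <-] -[<- <-] ? ? ? ?; exact: And4.
exists ((x, y, a), c); split => //.
apply/allpairsP; exists ((x, y), a); split => //.
by apply/allpairsP; exists (x, y).
Qed.

Definition quads (n : nat) : seq (int * int * int * int) :=
  [seq q <- box n | let: (x, y, a, c) := q in
     [&& 0 < x, 0 < y, 0 < a, 0 < c & x * y + a * c == n%:Z]].

Lemma uniq_quads n : uniq (quads n).
Proof. exact/filter_uniq/uniq_box. Qed.

(** All four variables are positive, so each is at most [n] and the enclosing box loses no
    solution. *)
Lemma mem_quads n x y a c :
  ((x, y, a, c) \in quads n) =
  [&& 0 < x, 0 < y, 0 < a, 0 < c & x * y + a * c == n%:Z].
Proof.
rewrite mem_filter mem_box; apply: andb_idr => /and5P[x0 y0 a0 c0 /eqP eq_n].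
by apply/and4P; split; nia.
Qed.

Definition oddz (x : int) : bool := (x %% 2)%Z == 1.
Definition sumq (R : nmodType) n (P : int -> int -> int -> int -> bool)
    (F : int -> int -> int -> int -> R) : R :=
  \sum_(q <- quads n | let: (x, y, a, c) := q in P x y a c)
    let: (x, y, a, c) := q in F x y a c.

Lemma sumq_reindex (R : nmodType) n (P Q : int -> int -> int -> int -> bool)
    (h g : int -> int -> int -> int -> int * int * int * int)
    (F : int -> int -> int -> int -> R) :
  (forall x y a c, (x, y, a, c) \in quads n -> P x y a c ->
     let: (x', y', a', c') := h x y a c in
     [/\ (x', y', a', c') \in quads n, Q x' y' a' c' & g x' y' a' c' = (x, y, a, c)]) ->
  (forall x y a c, (x, y, a, c) \in quads n -> Q x y a c ->
     let: (x', y', a', c') := g x y a c in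
     [/\ (x', y', a', c') \in quads n, P x' y' a' c' & h x' y' a' c' = (x, y, a, c)]) ->
  sumq n Q F = sumq n P (fun x y a c => let: (x', y', a', c') := h x y a c in F x' y' a' c').
Proof.
move=> hP gQ; pose H q := let: (x, y, a, c) := q in h x y a c.
pose G q := let: (x, y, a, c) := q in g x y a c.
rewrite /sumq (@big_reindex_cond _ _ _ (quads n) (quads n)
  (fun q => let: (x, y, a, c) := q in P x y a c)
  (fun q => let: (x, y, a, c) := q in Q x y a c) H G) ?uniq_quads //.
- by apply: eq_bigr => -[[[x y] a] c] _ /=; case: (h x y a c) => [[[]]].
- move=> [[[x y] a] c] /= qs Pq; have := hP x y a c qs Pq.
  by case: (h x y a c) => [[[x' y'] a'] c'] /=.
- move=> [[[x y] a] c] /= qs Pq; have := gQ x y a c qs Pq.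
  by case: (g x y a c) => [[[x' y'] a'] c'] /=.
Qed.

(** For odd [n] exactly one of the products [x y] and [a c] is odd. After exchanging the two
    products and the factors of the even one, every solution has exactly one even variable, [a], or
    exactly two, [a] and [c]. *)
Definition typeI (x y a c : int) := [&& oddz x, oddz y, ~~ oddz a & oddz c].
Definition typeII (x y a c : int) := [&& oddz x, oddz y, ~~ oddz a & ~~ oddz c].

Ltac quad_bij := move=> x y a c; rewrite !mem_quads /typeI /typeII /oddz;
  move=> H1 H2; split; first [by congr (_, _, _, _); lia | by rewrite ?mem_quads; nia | lia].

Section Relations.
Variables (R : nmodType) (n : nat) (F : int -> int -> int -> int -> R).

Lemma sumI_swap : sumq n typeI F = sumq n typeI (fun x y a c => F y x a c).
Proof. by apply: (@sumq_reindex _ _ _ _ (fun x y a c => (y, x, a, c)) (fun x y a c => (y, x, a, c))); quad_bij. Qed.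

Lemma sumII_swapl : sumq n typeII F = sumq n typeII (fun x y a c => F y x a c).
Proof. by apply: (@sumq_reindex _ _ _ _ (fun x y a c => (y, x, a, c)) (fun x y a c => (y, x, a, c))); quad_bij. Qed.

Lemma sumII_swapr : sumq n typeII F = sumq n typeII (fun x y a c => F x y c a).
Proof. by apply: (@sumq_reindex _ _ _ _ (fun x y a c => (x, y, c, a)) (fun x y a c => (x, y, c, a))); quad_bij. Qed.

(** [c (a - x) + (y + c) x = x y + a c]. The map is an involution of the part [x < a], since its
    image satisfies [c < y + c], and [y + c] is the new even variable. The next lemma rests in the
    same way on [(a + y) c + (x - c) y]. *)
Lemma sumI_move1 :
  sumq n (fun x y a c => typeI x y a c && (x < a)) F =
  sumq n (fun x y a c => typeI x y a c && (x < a)) (fun x y a c => F c (a - x) (y + c) x).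
Proof.
by apply: (@sumq_reindex _ _ _ _ (fun x y a c => (c, a - x, y + c, x))
  (fun x y a c => (c, a - x, y + c, x))); quad_bij.
Qed.

Lemma sumI_move2 :
  sumq n (fun x y a c => typeI x y a c && (c < x)) F =
  sumq n (fun x y a c => typeI x y a c && (c < x)) (fun x y a c => F (a + y) c (x - c) y).
Proof.
by apply: (@sumq_reindex _ _ _ _ (fun x y a c => (a + y, c, x - c, y))
  (fun x y a c => (a + y, c, x - c, y))); quad_bij.
Qed.

(** [y (x - a) + a (c + y) = x y + a c], and [c + y] is even when [c] and [y] are odd: this map and
    the next one change the parity type, and so link the two sums. *)
Lemma sumI_move3 :
  sumq n (fun x y a c => typeII x y a c && (x < c)) F =
  sumq n (fun x y a c => typeI x y a c && (a < x)) (fun x y a c => F y (x - a) a (c + y)).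
Proof.
by apply: (@sumq_reindex _ _ _ _ (fun x y a c => (y, x - a, a, c + y))
  (fun x y a c => (y + a, x, a, c - x))); quad_bij.
Qed.

Lemma sumI_move4 :
  sumq n (fun x y a c => typeII x y a c && (a < y)) F =
  sumq n (fun x y a c => typeI x y a c && (x < c)) (fun x y a c => F x (y + a) a (c - x)).
Proof.
by apply: (@sumq_reindex _ _ _ _ (fun x y a c => (x, y + a, a, c - x))
  (fun x y a c => (x, y - a, a, c + x))); quad_bij.
Qed.

End Relations.

(** * A verified checker for piecewise constant identities *)

(** The same record serves for points and for linear forms, [lval] being the dot product. The
    coefficients lie in [Z] so that the checker can be run by [vm_compute]. *)
Record lin := Lin { lx : Z; ly : Z; la : Z; lc : Z }.
Definition lval (v l : lin) : Z :=
  Z.add (Z.add (Z.mul (lx l) (lx v)) (Z.mul (ly l) (ly v)))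
        (Z.add (Z.mul (la l) (la v)) (Z.mul (lc l) (lc v))).
Definition lcomb (s : Z) (u v : lin) : lin :=
  Lin (Z.add (lx u) (Z.mul s (lx v))) (Z.add (ly u) (Z.mul s (ly v)))
      (Z.add (la u) (Z.mul s (la v))) (Z.add (lc u) (Z.mul s (lc v))).

(* Piecewise constant functions on the positive orthant: [Sgn l] is [2], [1] or [0] according to
   the sign of [l], and [Pos l e f] is [e] where [l > 0] and [f] elsewhere. *)
Inductive pw : Type :=
| Cst of Z | Sgn of lin | Add of pw & pw | Mul of pw & pw | Pos of lin & pw & pw.

Definition sgnv (z : Z) : Z := match z with Z0 => 1 | Zpos _ => 2 | Zneg _ => 0 end.

Fixpoint eval (v : lin) (e : pw) : Z :=
  match e with
  | Cst z => z
  | Sgn l => sgnv (lval v l)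
  | Add e f => Z.add (eval v e) (eval v f)
  | Mul e f => Z.mul (eval v e) (eval v f)
  | Pos l e f => if Z.ltb 0 (lval v l) then eval v e else eval v f
  end.

Record sub := Sub { sx : lin; sy : lin; sa : lin; sc : lin }.
Definition lsub (s : sub) (l : lin) : lin :=
  lcomb (lx l) (lcomb (ly l) (lcomb (la l) (lcomb (lc l) (Lin 0 0 0 0) (sc s)) (sa s)) (sy s))
    (sx s).
Definition vsub (s : sub) (v : lin) : lin :=
  Lin (lval v (sx s)) (lval v (sy s)) (lval v (sa s)) (lval v (sc s)).

Fixpoint subst (s : sub) (e : pw) : pw :=
  match e with
  | Cst z => Cst z
  | Sgn l => Sgn (lsub s l)
  | Add e f => Add (subst s e) (subst s f)
  | Mul e f => Mul (subst s e) (subst s f)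
  | Pos l e f => Pos (lsub s l) (subst s e) (subst s f)
  end.

Lemma lval_sub s v l : lval v (lsub s l) = lval (vsub s v) l.
Proof. by case: s l v => -[? ? ? ?] [? ? ? ?] [? ? ? ?] [? ? ? ?] [? ? ? ?] [? ? ? ?]; rewrite /lval /lsub /vsub /lval /=; ring. Qed.

Lemma eval_subst s v e : eval v (subst s e) = eval (vsub s v) e.
Proof. by elim: e => //= [l|e -> f ->|e -> f ->|l e -> f ->]; rewrite ?lval_sub. Qed.

Inductive coord := CX | CY | CA | CC.
Definition getc (i : coord) (l : lin) : Z :=
  match i with CX => lx l | CY => ly l | CA => la l | CC => lc l end.
Definition setc (i : coord) (z : Z) (l : lin) : lin :=
  match i with
  | CX => Lin z (ly l) (la l) (lc l) | CY => Lin (lx l) z (la l) (lc l)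
  | CA => Lin (lx l) (ly l) z (lc l) | CC => Lin (lx l) (ly l) (la l) z
  end.
Definition unitc (i : coord) : lin := setc i 1 (Lin 0 0 0 0).
Definition setsub (i : coord) (l : lin) : sub :=
  let d := Sub (unitc CX) (unitc CY) (unitc CA) (unitc CC) in
  match i with
  | CX => Sub l (sy d) (sa d) (sc d) | CY => Sub (sx d) l (sa d) (sc d)
  | CA => Sub (sx d) (sy d) l (sc d) | CC => Sub (sx d) (sy d) (sa d) l
  end.

Definition coords := [:: CX; CY; CA; CC].
Definition maxc (l : lin) : coord :=
  foldl (fun i k => if Z.ltb (getc i l) (getc k l) then k else i) CX coords.
Definition minc (l : lin) : coord :=
  foldl (fun i k => if Z.ltb (getc k l) (getc i l) then k else i) CX coords.

(* The sign of [l] on the open positive orthant, or two coordinates to compare. *)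
Definition lsign (l : lin) : comparison + coord * coord :=
  match Z.ltb 0 (getc (maxc l) l), Z.ltb (getc (minc l) l) 0 with
  | false, false => inl Eq
  | true, false => inl Gt
  | false, true => inl Lt
  | true, true => inr (maxc l, minc l)
  end.

Definition add' e f :=
  match e, f with
  | Cst u, Cst v => Cst (Z.add u v) | Cst Z0, _ => f | _, Cst Z0 => e | _, _ => Add e f
  end.
Definition mul' e f :=
  match e, f with
  | Cst Z0, _ => Cst 0 | _, Cst Z0 => Cst 0 | Cst u, Cst v => Cst (Z.mul u v)
  | _, _ => Mul e f
  end.

Fixpoint simp (e : pw) : pw :=
  match e with
  | Cst z => Cst z
  | Sgn l => match lsign l with
             | inl Eq => Cst 1 | inl Gt => Cst 2 | inl Lt => Cst 0 | inr _ => Sgn l end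
  | Add e f => add' (simp e) (simp f)
  | Mul e f => mul' (simp e) (simp f)
  | Pos l e f => match lsign l with
                 | inl Gt => simp e | inl _ => simp f | inr _ => Pos l (simp e) (simp f) end
  end.

Definition norm1 (l : lin) : Z :=
  Z.add (Z.add (Z.abs (lx l)) (Z.abs (ly l))) (Z.add (Z.abs (la l)) (Z.abs (lc l))).

Definition least (u v : option (Z * (coord * coord))) :=
  match u, v with
  | Some (m, _), Some (n, _) => if Z.leb m n then u else v
  | None, _ => v
  | _, None => u
  end.

(** Any pair of distinct coordinates would be a sound choice for the next comparison. Taking the
    form of least norm is a heuristic that simplifies the nearly determined signs first. *)
Fixpoint undet (e : pw) : option (Z * (coord * coord)) :=
  match e with
  | Cst z => None
  | Sgn l | Pos l _ _ => if lsign l is inr ij then Some (norm1 l, ij) else None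
  | Add e f | Mul e f => least (undet e) (undet f)
  end.

(* Euclid's algorithm on the orthant: [v_i > v_j], [v_i = v_j] and [v_i < v_j] are parametrised
   again by positive coordinates, until every sign is determined.  [r] holds the residues of the
   coordinates modulo [m]; branches that contradict them are dropped. *)
Fixpoint vanishes (n : nat) (m : Z) (r : lin) (e : pw) : bool :=
  match simp e with
  | Cst z => Z.eqb z 0
  | e' =>
    match n, undet e' with
    | n'.+1, Some (_, (i, j)) =>
      [&& vanishes n' m (setc i (Z.modulo (Z.sub (getc i r) (getc j r)) m) r)
            (subst (setsub i (lcomb 1 (unitc i) (unitc j))) e'),
          ~~ Z.eqb (getc i r) (getc j r) || vanishes n' m r (subst (setsub i (unitc j)) e')
        & vanishes n' m (setc j (Z.modulo (Z.sub (getc j r) (getc i r)) m) r)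
            (subst (setsub j (lcomb 1 (unitc j) (unitc i))) e')]
    | _, _ => false
    end
  end.

Definition positive (v : lin) := forall i, Z.lt 0 (getc i v).
Definition residue m (r v : lin) := forall i, Z.modulo (getc i v) m = getc i r.

Lemma maxc_ge l k : Z.le (getc k l) (getc (maxc l) l).
Proof.
by case: l => ? ? ? ?; rewrite /maxc /=; do ![case: Z.ltb_spec => /=]; case: k => /=; lia.
Qed.

Lemma minc_le l k : Z.le (getc (minc l) l) (getc k l).
Proof.
by case: l => ? ? ? ?; rewrite /minc /=; do ![case: Z.ltb_spec => /=]; case: k => /=; lia.
Qed.

Lemma lsign_pos l v : positive v ->
  match lsign l with
  | inl c => Z.compare (lval v l) 0 = c
  | inr (i, j) => Z.lt 0 (getc i l) /\ Z.lt (getc j l) 0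
  end.
Proof.
move=> v0; rewrite /lsign /lval.
have := v0 CX; have := v0 CY; have := v0 CA; have := v0 CC => /=.
have := @maxc_ge l CX; have := @maxc_ge l CY; have := @maxc_ge l CA; have := @maxc_ge l CC => /=.
have := @minc_le l CX; have := @minc_le l CY; have := @minc_le l CA; have := @minc_le l CC => /=.
case: Z.ltb_spec => Hmax; case: Z.ltb_spec => // Hmin *.
- by apply/Z.compare_gt_iff; case: (maxc l) Hmax => /=; nia.
- by apply/Z.compare_lt_iff; case: (minc l) Hmin => /=; nia.
- by apply/Z.compare_eq_iff; nia.
Qed.

Lemma eval_add' v e f : eval v (add' e f) = Z.add (eval v e) (eval v f).
Proof. by case: e f => [[|?|?]|?|? ?|? ?|? ? ?] [[|?|?]|?|? ?|? ?|? ? ?] //=; lia. Qed.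

Lemma eval_mul' v e f : eval v (mul' e f) = Z.mul (eval v e) (eval v f).
Proof. by case: e f => [[|?|?]|?|? ?|? ?|? ? ?] [[|?|?]|?|? ?|? ?|? ? ?] //=; lia. Qed.

Lemma eval_simp v e : positive v -> eval v (simp e) = eval v e.
Proof.
move=> v0; elim: e => //= [l|e IHe f IHf|e IHe f IHf|l e IHe f IHf].
- have := lsign_pos l v0; case: (lsign l) => [[]|[]] //=;
  by case: (lval v l).
- by rewrite eval_add' IHe IHf.
- by rewrite eval_mul' IHe IHf.
- have := lsign_pos l v0; case: (lsign l) => [[] /= Hl|[i j] _ /=]; rewrite ?IHe ?IHf //;
  by case: (Z.compare_spec (lval v l) 0) Hl => // ? _; case: Z.ltb_spec => //; lia.
Qed.

Lemma eval_setsub i l v e :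
  eval v (subst (setsub i l) e) = eval (setc i (lval v l) v) e.
Proof.
rewrite eval_subst; congr eval.
by case: i v l => -[? ? ? ?] [? ? ? ?]; rewrite /vsub /lval /=; congr Lin; lia.
Qed.

Lemma setc_diff i j v e : i <> j ->
  eval (setc i (Z.sub (getc i v) (getc j v)) v)
       (subst (setsub i (lcomb 1 (unitc i) (unitc j))) e) = eval v e.
Proof.
move=> neq_ij; rewrite eval_setsub; congr eval.
by case: i j neq_ij v => -[] // _ [? ? ? ?]; rewrite /lval /=; congr Lin; lia.
Qed.

Lemma setc_same i j v e : getc i v = getc j v -> eval v (subst (setsub i (unitc j)) e) = eval v e.
Proof.
move=> eq_ij; rewrite eval_setsub; congr eval.
by case: i j v eq_ij => -[] [? ? ? ?] /= H; rewrite /lval /=; congr Lin; lia.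
Qed.

Lemma undet_neq e z i j : undet e = Some (z, (i, j)) -> i <> j.
Proof.
have lsignP l : lsign l = inr (i, j) -> i <> j.
  rewrite /lsign; case: Z.ltb_spec => // Hmax; case: Z.ltb_spec => // Hmin [<- <-] eq_ij.
  by rewrite eq_ij in Hmax; lia.
have leastP u v : least u v = Some (z, (i, j)) -> u = Some (z, (i, j)) \/ v = Some (z, (i, j)).
  by case: u v => [[m ?]|] [[n ?]|] /=; try case: Z.leb; auto.
elim: e => //= [l|e IHe f IHf|e IHe f IHf|l _ _ _ _].
- by case E: (lsign l) => [//|ij] [_ eq_ij]; apply: (lsignP l); rewrite E eq_ij.
- by case/leastP.
- by case/leastP.
- by case E: (lsign l) => [//|ij] [_ eq_ij]; apply: (lsignP l); rewrite E eq_ij.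
Qed.

Lemma positive_diff i j v : positive v -> Z.lt (getc j v) (getc i v) ->
  positive (setc i (Z.sub (getc i v) (getc j v)) v).
Proof.
move=> v0 lt_ji k; have := v0 k; case: i j k v lt_ji {v0} => -[] [] [? ? ? ?] /=; lia.
Qed.

Lemma residue_diff m i j r v : residue m r v ->
  residue m (setc i (Z.modulo (Z.sub (getc i r) (getc j r)) m) r)
            (setc i (Z.sub (getc i v) (getc j v)) v).
Proof.
move=> rv k; have := Zminus_mod (getc i v) (getc j v) m; rewrite !rv.
have := rv k; case: i j k r v {rv} => -[] [] [? ? ? ?] [? ? ? ?] //=.
Qed.

(** A substitution in the expression is matched by a move of the point: where [v_j < v_i], the
    expression with [v_i + v_j] for [v_i] is evaluated at the still positive point whose coordinate
    [i] is [v_i - v_j]. Exhausted fuel returns [false], so termination plays no part in the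
    argument. *)
Lemma vanishes_sound n m r e v :
  positive v -> residue m r v -> vanishes n m r e -> eval v e = 0%zz.
Proof.
elim: n r e v => [|n IHn] r e v v0 rv; rewrite -(eval_simp e v0) /=.
  by case: (simp e) => //= z /Z.eqb_eq.
have step e' : match undet e' with
    | Some (_, (i, j)) =>
      [&& vanishes n m (setc i (Z.modulo (Z.sub (getc i r) (getc j r)) m) r)
            (subst (setsub i (lcomb 1 (unitc i) (unitc j))) e'),
          ~~ Z.eqb (getc i r) (getc j r) || vanishes n m r (subst (setsub i (unitc j)) e')
        & vanishes n m (setc j (Z.modulo (Z.sub (getc j r) (getc i r)) m) r)
            (subst (setsub j (lcomb 1 (unitc j) (unitc i))) e')]
    | None => false end -> eval v e' = 0%zz.
  case E: (undet e') => [[z [i j]]|//] /and3P[Hgt Heq Hlt].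
  have neq_ij := undet_neq E.
  have [lt_ij|[eq_ij|lt_ji]] := Z.lt_trichotomy (getc i v) (getc j v).
  - rewrite -(@setc_diff j i v e') //; last by move/esym.
    by apply: IHn Hlt; [exact: positive_diff | exact: residue_diff].
  - rewrite -(setc_same e' eq_ij); apply: (IHn _ _ _ v0 rv).
    by case/orP: Heq => //; rewrite -!rv eq_ij Z.eqb_refl.
  - rewrite -(@setc_diff i j v e') //.
    by apply: IHn Hgt; [exact: positive_diff | exact: residue_diff].
case: (simp e) => [z /Z.eqb_eq //|l|e1 e2|e1 e2|l e1 e2].
- exact: (step (Sgn l)).
- exact: (step (Add e1 e2)).
- exact: (step (Mul e1 e2)).
- exact: (step (Pos l e1 e2)).
Qed.

(** * The identities *)

Declare Scope lin_scope.
Delimit Scope lin_scope with lin.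
Bind Scope lin_scope with lin.
Notation "p + q" := (lcomb 1 p q) : lin_scope.
Notation "p - q" := (lcomb (-1) p q) : lin_scope.
Declare Scope pw_scope.
Delimit Scope pw_scope with pw.
Bind Scope pw_scope with pw.
Notation "e + f" := (Add e f) : pw_scope.
Notation "k *: e" := (Mul (Cst k) e) : pw_scope.
Notation "e - f" := (Add e (Mul (Cst (-1)) f)) : pw_scope.
Notation "e * f" := (Mul e f) : pw_scope.
Notation vx := (unitc CX).
Notation vy := (unitc CY).
Notation va := (unitc CA).
Notation vc := (unitc CC).
Definition hv (p q : lin) : pw := Sgn (p - q).
Arguments hv (p q)%_lin.
Definition If0 (l : lin) (e f : pw) : pw := Pos l f (Pos (Lin 0 0 0 0 - l) f e).
Arguments If0 l%_lin (e f)%_pw.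
Arguments Pos l%_lin (e f)%_pw.
Arguments Sub (sx sy sa sc)%_lin.

(* The argument gives the residues modulo 4 of the point at which the function is evaluated. *)
Definition rfun := lin -> pw.
Definition rmod (r : lin) : lin :=
  Lin (Z.modulo (lx r) 4) (Z.modulo (ly r) 4) (Z.modulo (la r) 4) (Z.modulo (lc r) 4).
Definition move (s : sub) (F : rfun) : rfun := fun r => subst s (F (rmod (vsub s r))).

Open Scope pw_scope.
(* [F1], [F2] are transported by self-bijections of parts of type I, [F3], ..., [F6] by bijections
   between parts of the types I and II (lemmas [sumI_move1] to [sumI_move4]); the total of [flowI]
   over type I and [flowII] over type II is zero. *)
Definition flowI (F1 F2 F3 F4 F5 F6 : rfun) : rfun := fun r =>
  Pos (va - vx) (F1 r - move (Sub vc (va - vx) (vy + vc) vx) F1 r) (Cst 0)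
  + Pos (vx - vc) (F2 r - move (Sub (va + vy) vc (vx - vc) vy) F2 r) (Cst 0)
  - Pos (vx - va) (move (Sub vy (vx - va) va (vc + vy)) F3 r + F5 r) (Cst 0)
  - Pos (vc - vx) (move (Sub vx (vy + va) va (vc - vx)) F4 r + F6 r) (Cst 0).
Definition flowII (F3 F4 F5 F6 : rfun) : rfun := fun r =>
  Pos (vc - vx) (F3 r + move (Sub (vy + va) vx va (vc - vx)) F5 r) (Cst 0)
  + Pos (vy - va) (F4 r + move (Sub vx (vy - va) va (vc + vx)) F6 r) (Cst 0).
(** A sum over type I is unchanged by exchanging [x] and [y], and one over type II also by
    exchanging [a] and [c]. The identities are therefore required only after symmetrisation, which
    leaves much more freedom for the tables. *)
Definition symI (F : rfun) : rfun := fun r => F r + move (Sub vy vx va vc) F r.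
Definition symII (F : rfun) : rfun := fun r => symI F r + move (Sub vx vy vc va) (symI F) r.

(** On positive arguments this tests [|u - v| <= 2 p] and [|u - v| <= 2 q]: each test gives 4
    inside, 2 in case of equality and 0 outside. Likewise [triw] is 8 on nondegenerate triangles
    with sides [t], [p], [q], 4 on degenerate ones and 0 otherwise. The halving on the walls
    reproduces the weight of a vanishing variable of the triple. *)
Definition innerw (u v p q : lin) : pw :=
  hv (p + p + v) u * hv (p + p + u) v * (hv (q + q + v) u * hv (q + q + u) v).
Definition triw (t p q : lin) : pw := hv t (p - q) * hv t (q - p) * hv (p + q) t.
Arguments innerw (u v p q)%_lin.
Arguments triw (t p q)%_lin.

(* The tables FB, FE, FC are for odd [r], even [r] and [r = p - 1] modulo 4.  Their coefficients were
   found by a computer search. *)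
Definition FB1 : rfun := fun _ =>
  4 *: ((hv vy (vx + vc) - hv (vx + vc) vy) * hv va vy) - 16 *: hv va vc.
Definition FB2 : rfun := fun _ => 16 *: hv va vc.
Definition FB3 : rfun := fun _ => 8 *: hv va vx.
Definition FB4 : rfun := fun _ =>
  8 *: hv (va + vc) vy + 4 *: ((hv vc (vx + va) - hv (vx + va) vc) * hv vy vc).
Definition FB5 : rfun := fun _ => -16 *: hv vc va.
Definition FB6 : rfun := fun _ => 8 *: hv vc va - 8 *: hv va vc.
(** Half of what all arrangements of one solution contribute for odd [r]: there every term has an
    even coefficient. For even [r] the contributions [TEI] and [TEII] are taken in full. *)
Definition TBI : rfun := fun _ => innerw va vc vx vy + 2 *: triw vc vx vy.
Definition TBII : rfun := fun _ => 2 *: triw vx va vc.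

Definition FE1 : rfun := fun _ => 8 *: hv vc vx - 8 *: hv va (vx + vy) - 32 *: hv vx vy.
Definition FE2 : rfun := fun _ =>
  8 *: hv (va + vc) vx - 48 *: hv vx vy + 8 *: ((hv va (vy + vc) - hv (vy + vc) va) * hv vx va).
Definition FE3 : rfun := fun _ =>
  16 *: hv (vx + vy) vc - 32 *: hv vc va + 8 *: ((hv vy (vx + va) - hv (vx + va) vy) * hv vc vy).
Definition FE4 : rfun := fun _ => 56 *: hv vx vy - 16 *: hv va vc - 8 *: hv vy vx.
Definition FE5 : rfun := fun _ => 32 *: hv vx vy + 16 *: (hv (vy + va) vc * hv vx (vy + va)).
Definition FE6 : rfun := fun _ =>
  8 *: (hv vc (vx + va) * hv (vx + va) vy) + 4 *: ((hv (vx + va) vy - hv vy (vx + va)) * hv vc vy)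
  - 32 *: hv vy vx.
Definition TEI : rfun := fun _ => 2 *: innerw vx vy va vc + 4 *: triw va vx vy + 8 *: triw vx va vc.
Definition TEII : rfun := fun _ => innerw vx vy va vc + innerw va vc vx vy + 4 *: triw va vx vy.

(* Residue conditions are imposed up to a common sign. *)
Definition at4 (i j k l : Z) (r : lin) (e : pw) : pw :=
  let r0 := Lin i j k l in
  if [&& Z.eqb (lx r) i, Z.eqb (ly r) j, Z.eqb (la r) k & Z.eqb (lc r) l]
  || [&& Z.eqb (lx r) (Z.modulo (- i) 4), Z.eqb (ly r) (Z.modulo (- j) 4),
         Z.eqb (la r) (Z.modulo (- k) 4) & Z.eqb (lc r) (Z.modulo (- l) 4)]
  then e else Cst 0.
Arguments at4 (i j k l)%_zz r e%_pw.

Definition FC1 : rfun := fun r =>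
  at4 1 1 0 1 r (Cst 16) - at4 1 1 0 3 r (8 *: hv vx vc)
  + at4 1 3 0 3 r (16 *: hv vc vx) + at4 1 3 2 3 r (8 *: hv vc vx).
Definition FC2 : rfun := fun r =>
  at4 1 1 0 1 r (8 *: hv vx (va + vc))
  + at4 1 3 2 1 r (24 *: hv vy vx - 8 *: hv vx vy)
  - at4 1 1 2 3 r (32 *: hv vx vy)
  + at4 1 3 0 3 r (16 *: hv vx (va + vc))
  - at4 1 3 2 3 r (8 *: hv (va + vc) vx + 32 *: hv vx vy)
  + at4 1 1 2 1 r (32 *: hv vy vx).
Definition FC3 : rfun := fun r =>
  at4 1 1 0 2 r (8 *: hv (vx + vy) vc - 8 *: hv vc (vx + vy))
  + at4 1 1 2 2 r (8 *: hv (vx + vy) vc - 8 *: hv vc (vx + vy))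
  + at4 1 1 2 0 r (Cst 16) - at4 1 1 0 0 r (Cst 16)
  + at4 1 3 2 2 r (16 *: hv (vx + vy) vc).
Definition FC4 : rfun := fun r =>
  at4 1 1 0 2 r (Cst 16) + at4 1 1 0 0 r (Cst 16) + at4 1 3 0 2 r (Cst 32).
Definition FC5 : rfun := fun r =>
  (if Z.eqb (Z.modulo (Z.add (lx r) (lc r)) 4) 0
   then 8 *: ((hv (vy + va) vc - hv vc (vy + va)) * hv vx vc) else Cst 0)
  - at4 1 3 0 3 r (16 *: hv (va + vc) vx).
Definition FC6 : rfun := fun r =>
  at4 1 3 2 1 r (8 *: hv vx vy - 24 *: hv vy vx)
  + at4 1 1 2 3 r (16 *: hv vx vy - 16 *: hv vy vx)
  + at4 1 3 2 3 r (24 *: hv vx vy - 8 *: hv vy vx)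
  + at4 1 1 2 1 r (16 *: hv vx vy - 16 *: hv vy vx).
(** On type II [a c] is divisible by 4, so [p] is congruent to [x y]. The condition that [r] is
    congruent to [p - 1] becomes a condition on the residues of the point, and one table serves all
    primes. *)
Definition TCII : rfun := fun r =>
  (if Z.eqb (Z.modulo (Z.add (la r) (lc r)) 4)
            (Z.modulo (Z.sub (Z.mul (lx r) (ly r)) 1) 4)
   then innerw va vc vx vy else Cst 0)
  + (if Z.eqb (la r) 2 then 4 *: triw va vx vy else Cst 0).

(* away from the degenerate configurations that a prime excludes *)
Definition guardI (e : pw) : pw :=
  If0 (vx - vc) (Pos (va - vx) (Pos (vx - vy) (Cst 0) e) (Cst 0))
   (If0 (vy - vc) (Pos (va - vy) (Pos (vy - vx) (Cst 0) e) (Cst 0)) e).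
Definition guardII (e : pw) : pw :=
  let g1 e := If0 (vx - vy) (If0 (vc - va - vx - vx) (Cst 0) (If0 (va - vc - vx - vx) (Cst 0) e)) e in
  let g2 e := If0 (va - vc) (If0 (vy - vx - va - va) (Cst 0) (If0 (vx - vy - va - va) (Cst 0) e)) e in
  g1 (g2 e).

(** Parity excludes the special configurations from type I. The identity there is still not void:
    flow passes through type I and leaves the correction [bdC]. *)
Definition TCI : rfun := fun _ => Cst 0.
(** Corrections on the wall [x = c]. The further case [y = c] in the other two occurs, for a prime,
    only at the single point [(1, 1, p - 1, 1)]. *)
Definition bdB : rfun := fun _ => If0 (vx - vc) (Cst 32) (Cst 0).
Definition bdE : rfun := fun _ => If0 (vx - vc) (Cst 128 - If0 (vy - vc) (Cst 48) (Cst 0)) (Cst 0).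
Definition bdC : rfun := fun r =>
  If0 (vx - vc) (at4 1 1 0 1 r (Cst (-16)) + at4 1 3 2 1 r (Cst 48) + at4 1 1 2 1 r (Cst 32)
    - If0 (vy - vc) (at4 1 1 2 1 r (Cst 32)) (Cst 0)) (Cst 0).
Close Scope pw_scope.

Definition residues (k : Z) := [:: k; Z.add k 2].
Definition all_residues (l : Z) (P : lin -> bool) : bool :=
  all (fun i => all (fun j => all (fun k => all (fun l => P (Lin i j k l))
    (residues l)) (residues 0)) (residues 1)) (residues 1).

(** Type II needs no correction, because its walls [x = c] and [y = a] separate numbers of different
    parity. The number 60 bounds the depth of the case analysis; too small a bound could only make
    the check fail. *)
Definition balanced (TI TII bd F1 F2 F3 F4 F5 F6 : rfun) : bool :=
  all_residues 1 (fun r => vanishes 60 4 r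
    (guardI (symI TI r - (symI (flowI F1 F2 F3 F4 F5 F6) r + symI bd r))%pw)) &&
  all_residues 0 (fun r => vanishes 60 4 r
    (guardII (symII TII r - symII (flowII F3 F4 F5 F6) r)%pw)).

Lemma balancedB : balanced TBI TBII bdB FB1 FB2 FB3 FB4 FB5 FB6.
Proof. by vm_compute. Qed.

Lemma balancedE : balanced TEI TEII bdE FE1 FE2 FE3 FE4 FE5 FE6.
Proof. by vm_compute. Qed.

Lemma balancedC : balanced TCI TCII bdC FC1 FC2 FC3 FC4 FC5 FC6.
Proof. by vm_compute. Qed.

(** * Values at integer points, with the residues read off the point *)

Definition valz (F : rfun) (v : lin) : Z := eval v (F (rmod v)).

(** The coordinates of the image are integral linear forms, so their residues depend only on the
    residues of the point. This is why [move] may compute the residues before any point is known. *)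
Lemma valz_move s F v : valz (move s F) v = valz F (vsub s v).
Proof.
rewrite /valz /move eval_subst; congr (eval _ (F _)).
have lval_mod l : Z.modulo (lval (rmod v) l) 4 = Z.modulo (lval v l) 4.
  have -> : lval v l = Z.add (lval (rmod v) l)
      (Z.mul (lval (Lin (Z.div (lx v) 4) (Z.div (ly v) 4) (Z.div (la v) 4) (Z.div (lc v) 4)) l) 4).
    rewrite /lval /=; move: (Z.div_mod (lx v) 4) (Z.div_mod (ly v) 4) (Z.div_mod (la v) 4)
      (Z.div_mod (lc v) 4) => Hx Hy Ha Hc.
    by rewrite {1}Hx // {1}Hy // {1}Ha // {1}Hc //; ring.
  by rewrite Z.mod_add.
by case: s => *; rewrite /vsub /rmod /= !lval_mod.
Qed.

Lemma vsub_swapl v : vsub (Sub vy vx va vc) v = Lin (ly v) (lx v) (la v) (lc v).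
Proof. by case: v => *; rewrite /vsub /lval /=; congr Lin; lia. Qed.

Lemma vsub_swapr v : vsub (Sub vx vy vc va) v = Lin (lx v) (ly v) (lc v) (la v).
Proof. by case: v => *; rewrite /vsub /lval /=; congr Lin; lia. Qed.

Lemma valz_symI F v :
  valz (symI F) v = Z.add (valz F v) (valz F (Lin (ly v) (lx v) (la v) (lc v))).
Proof.
have -> : valz (symI F) v = Z.add (valz F v) (valz (move (Sub vy vx va vc) F) v) by [].
by rewrite valz_move vsub_swapl.
Qed.

Lemma valz_symII F v :
  valz (symII F) v = Z.add (valz (symI F) v) (valz (symI F) (Lin (lx v) (ly v) (lc v) (la v))).
Proof.
have -> : valz (symII F) v =
  Z.add (valz (symI F) v) (valz (move (Sub vx vy vc va) (symI F)) v) by [].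
by rewrite valz_move vsub_swapr.
Qed.

Definition pt (x y a c : int) : lin :=
  Lin (Z_of_int x) (Z_of_int y) (Z_of_int a) (Z_of_int c).
Definition val (F : rfun) (x y a c : int) : int := int_of_Z (valz F (pt x y a c)).

Lemma val_symI F x y a c : val (symI F) x y a c = val F x y a c + val F y x a c.
Proof. by rewrite /val /pt valz_symI /=; lia. Qed.

Lemma val_symII F x y a c :
  val (symII F) x y a c = val (symI F) x y a c + val (symI F) x y c a.
Proof. by rewrite /val /pt valz_symII /=; lia. Qed.

Lemma val_flowI F1 F2 F3 F4 F5 F6 x y a c :
  val (flowI F1 F2 F3 F4 F5 F6) x y a c =
  (if x < a then val F1 x y a c - val F1 c (a - x) (y + c) x else 0)
  + (if c < x then val F2 x y a c - val F2 (a + y) c (x - c) y else 0)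
  - (if a < x then val F3 y (x - a) a (c + y) + val F5 x y a c else 0)
  - (if x < c then val F4 x (y + a) a (c - x) + val F6 x y a c else 0).
Proof.
pose v := pt x y a c.
have -> : val (flowI F1 F2 F3 F4 F5 F6) x y a c = int_of_Z (
    Z.add (Z.add (Z.add
    (if Z.ltb 0 (lval v (va - vx)%lin) then
       Z.add (valz F1 v) (Z.mul (-1) (valz (move (Sub vc (va - vx) (vy + vc) vx) F1) v)) else 0%zz)
    (if Z.ltb 0 (lval v (vx - vc)%lin) then
       Z.add (valz F2 v) (Z.mul (-1) (valz (move (Sub (va + vy) vc (vx - vc) vy) F2) v)) else 0%zz))
    (Z.mul (-1) (if Z.ltb 0 (lval v (vx - va)%lin) then
       Z.add (valz (move (Sub vy (vx - va) va (vc + vy)) F3) v) (valz F5 v) else 0%zz)))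
    (Z.mul (-1) (if Z.ltb 0 (lval v (vc - vx)%lin) then
       Z.add (valz (move (Sub vx (vy + va) va (vc - vx)) F4) v) (valz F6 v) else 0%zz))) by [].
rewrite !valz_move /val -/v.
have -> : vsub (Sub vc (va - vx) (vy + vc) vx) v = pt c (a - x) (y + c) x.
  by rewrite /vsub /pt /lval /=; congr Lin; lia.
have -> : vsub (Sub (va + vy) vc (vx - vc) vy) v = pt (a + y) c (x - c) y.
  by rewrite /vsub /pt /lval /=; congr Lin; lia.
have -> : vsub (Sub vy (vx - va) va (vc + vy)) v = pt y (x - a) a (c + y).
  by rewrite /vsub /pt /lval /=; congr Lin; lia.
have -> : vsub (Sub vx (vy + va) va (vc - vx)) v = pt x (y + a) a (c - x).
  by rewrite /vsub /pt /lval /=; congr Lin; lia.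
have -> : Z.ltb 0 (lval v (va - vx)%lin) = (x < a) by rewrite /v /lval /=; lia.
have -> : Z.ltb 0 (lval v (vx - vc)%lin) = (c < x) by rewrite /v /lval /=; lia.
have -> : Z.ltb 0 (lval v (vx - va)%lin) = (a < x) by rewrite /v /lval /=; lia.
have -> : Z.ltb 0 (lval v (vc - vx)%lin) = (x < c) by rewrite /v /lval /=; lia.
by case: (x < a); case: (c < x); case: (a < x); case: (x < c); lia.
Qed.

Lemma val_flowII F3 F4 F5 F6 x y a c :
  val (flowII F3 F4 F5 F6) x y a c =
  (if x < c then val F3 x y a c + val F5 (y + a) x a (c - x) else 0)
  + (if a < y then val F4 x y a c + val F6 x (y - a) a (c + x) else 0).
Proof.
pose v := pt x y a c.
have -> : val (flowII F3 F4 F5 F6) x y a c = int_of_Z (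
    Z.add
    (if Z.ltb 0 (lval v (vc - vx)%lin) then
       Z.add (valz F3 v) (valz (move (Sub (vy + va) vx va (vc - vx)) F5) v) else 0%zz)
    (if Z.ltb 0 (lval v (vy - va)%lin) then
       Z.add (valz F4 v) (valz (move (Sub vx (vy - va) va (vc + vx)) F6) v) else 0%zz)) by [].
rewrite !valz_move /val -/v.
have -> : vsub (Sub (vy + va) vx va (vc - vx)) v = pt (y + a) x a (c - x).
  by rewrite /vsub /pt /lval /=; congr Lin; lia.
have -> : vsub (Sub vx (vy - va) va (vc + vx)) v = pt x (y - a) a (c + x).
  by rewrite /vsub /pt /lval /=; congr Lin; lia.
have -> : Z.ltb 0 (lval v (vc - vx)%lin) = (x < c) by rewrite /v /lval /=; lia.
have -> : Z.ltb 0 (lval v (vy - va)%lin) = (a < y) by rewrite /v /lval /=; lia.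
by case: (x < c); case: (a < y); lia.
Qed.

(** * Balance for a prime *)

Lemma sumq_if (R : nmodType) n P (g : int -> int -> int -> int -> bool)
    (F : int -> int -> int -> int -> R) :
  sumq n P (fun x y a c => if g x y a c then F x y a c else 0) =
  sumq n (fun x y a c => P x y a c && g x y a c) F.
Proof.
rewrite /sumq [RHS]big_mkcond [LHS]big_mkcond; apply: eq_bigr => -[[[x y] a] c] _.
by case: (P x y a c).
Qed.

Lemma eq_sumq (R : nmodType) n (P : int -> int -> int -> int -> bool)
    (F G : int -> int -> int -> int -> R) :
  (forall x y a c, (x, y, a, c) \in quads n -> P x y a c -> F x y a c = G x y a c) ->
  sumq n P F = sumq n P G.
Proof.
move=> eqFG; rewrite /sumq big_seq_cond [RHS]big_seq_cond; apply: eq_bigr.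
by move=> [[[x y] a] c] /andP[qs Pq]; exact: eqFG.
Qed.

Lemma sumqD (R : nmodType) n P (F G : int -> int -> int -> int -> R) :
  sumq n P (fun x y a c => F x y a c + G x y a c) = sumq n P F + sumq n P G.
Proof. by rewrite /sumq -big_split; apply: eq_bigr => -[[[x y] a] c]. Qed.

Lemma sumqN (R : zmodType) n P (F : int -> int -> int -> int -> R) :
  sumq n P (fun x y a c => - F x y a c) = - sumq n P F.
Proof. by rewrite /sumq -sumrN; apply: eq_bigr => -[[[x y] a] c]. Qed.

(** The differences for [F1] and [F2] cancel because the maps permute their domains. [F3] and [F4]
    appear with a plus sign on type II and, pulled back along the bijection, with a minus sign on
    type I. [F5] and [F6] use the same two bijections, but are given at the type I end. *)
Lemma flow_balance n F1 F2 F3 F4 F5 F6 :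
  sumq n typeI (val (flowI F1 F2 F3 F4 F5 F6)) + sumq n typeII (val (flowII F3 F4 F5 F6)) = 0.
Proof.
rewrite (eq_sumq (fun x y a c _ _ => val_flowI F1 F2 F3 F4 F5 F6 x y a c)).
rewrite (eq_sumq (fun x y a c _ _ => val_flowII F3 F4 F5 F6 x y a c)).
rewrite !sumqD !sumqN !sumq_if !sumqD !sumqN -!sumI_move1 -!sumI_move2 -!sumI_move3 -!sumI_move4.
rewrite (@sumI_move3 _ n (fun x y a c => val F5 (y + a) x a (c - x))).
rewrite (@sumI_move4 _ n (fun x y a c => val F6 x (y - a) a (c + x))).
rewrite (@eq_sumq _ n _ (fun x y a c => val F5 (x - a + a) y a (c + y - y)) (val F5)); last first.
  by move=> x y a c _ _; rewrite subrK addrK.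
rewrite (@eq_sumq _ n _ (fun x y a c => val F6 x (y + a - a) a (c - x + x)) (val F6)); last first.
  by move=> x y a c _ _; rewrite subrK addrK.
by ring.
Qed.

Lemma eval_If0 v l e f :
  eval v (If0 l e f) = if Z.eqb (lval v l) 0 then eval v e else eval v f.
Proof.
rewrite /If0 /= (_ : lval v (Lin 0 0 0 0 - l)%lin = Z.opp (lval v l)); last first.
  by case: v l => [? ? ? ?] [? ? ? ?]; rewrite /lval /=; nia.
by case: Z.ltb_spec => ?; [|case: Z.ltb_spec => ?]; case: Z.eqb_spec => ? //; lia.
Qed.

Lemma guardI_sound x y a c e :
  (x = c -> x < a /\ x <= y) -> (y = c -> y < a /\ y <= x) ->
  eval (pt x y a c) (guardI e) = 0%zz -> eval (pt x y a c) e = 0%zz.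
Proof.
move=> xc yc; rewrite /guardI !eval_If0 /= /lval /=.
case: Z.eqb_spec => [exc|_].
  case: Z.ltb_spec => [_|]; last by case: xc; lia.
  by case: Z.ltb_spec => //; case: xc; lia.
case: Z.eqb_spec => // eyc.
case: Z.ltb_spec => [_|]; last by case: yc; lia.
by case: Z.ltb_spec => //; case: yc; lia.
Qed.

Lemma guardII_sound x y a c e :
  (x = y -> c <> a + 2 * x /\ a <> c + 2 * x) ->
  (a = c -> y <> x + 2 * a /\ x <> y + 2 * a) ->
  eval (pt x y a c) (guardII e) = 0%zz -> eval (pt x y a c) e = 0%zz.
Proof.
move=> xy ac; rewrite /guardII; set g2 := If0 (va - vc) _ _.
have g2P : eval (pt x y a c) g2 = 0%zz -> eval (pt x y a c) e = 0%zz.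
  rewrite /g2 !eval_If0 /lval /=; case: Z.eqb_spec => // eac.
  case: Z.eqb_spec => [|_]; first by case: ac; lia.
  by case: Z.eqb_spec => // ; case: ac; lia.
move: g2 g2P => g2 g2P; rewrite !eval_If0 /lval /=; case: Z.eqb_spec => // exy.
case: Z.eqb_spec => [|_]; first by case: xy; lia.
by case: Z.eqb_spec => [|_ //]; case: xy; lia.
Qed.

Lemma prime_factorz (p : nat) (x z : int) :
  prime p -> 0 < x -> 0 < z -> x * z = p%:Z -> x = 1 \/ z = 1.
Proof.
move=> p_pr x0 z0 eq_p; have eq_pn : (`|x| * `|z|)%N = p by lia.
have /primeP[p1 /(_ `|x|%N)] := p_pr; rewrite -{1}eq_pn dvdn_mulr // => /(_ isT)/pred2P.
by case=> ?; [left; lia | right; nia].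
Qed.

Lemma prime_not_square (p : nat) (z : int) : prime p -> z * z <> p%:Z.
Proof.
move=> p_pr eq_p; have p1 := prime_gt1 p_pr; have z0 : 0 < `|z| by nia.
have eq_np : `|z| * `|z| = p%:Z by rewrite -eq_p; nia.
by have [] := prime_factorz p_pr z0 z0 eq_np => z1; move: eq_np; rewrite z1; lia.
Qed.

(** The pointwise identities are summed over all solutions: symmetrisation doubles each sum over
    type I and quadruples each over type II, the flows cancel, and only the correction remains. *)
Lemma balanced_sum (p : nat) TI TII bd F1 F2 F3 F4 F5 F6 :
  prime p -> balanced TI TII bd F1 F2 F3 F4 F5 F6 ->
  sumq p typeI (val TI) + sumq p typeII (val TII) = sumq p typeI (val bd).
Proof.
move=> p_pr; rewrite /balanced => /andP[balI balII].
have posP x y a c : (x, y, a, c) \in quads p -> positive (pt x y a c).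
  by rewrite mem_quads => H [] /=; lia.
have resP v : residue 4 (rmod v) v by case.
have inP k (P : pred Z) z : Z.modulo z 2 = k -> all P (residues k) -> P (Z.modulo z 4).
  move=> zk /= /and3P[Pk Pk2 _].
  have [->|->] // : Z.modulo z 4 = k \/ Z.modulo z 4 = Z.add k 2.
  have := Z.mod_pos_bound z 4 ltac:(done); have := Z.div_mod z 4 ltac:(done).
  have := Z.mod_pos_bound z 2 ltac:(done); have := Z.div_mod z 2 ltac:(done); lia.
have all_resP l (P : pred lin) v : all_residues l P -> Z.modulo (lx v) 2 = 1%zz ->
    Z.modulo (ly v) 2 = 1%zz -> Z.modulo (la v) 2 = 0%zz -> Z.modulo (lc v) 2 = l -> P (rmod v).
  rewrite /all_residues => allP xo yo ae cl.
  exact: (inP _ _ _ cl (inP _ _ _ ae (inP _ _ _ yo (inP _ _ _ xo allP)))).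
have mod2 (t : int) : Z.modulo (Z_of_int t) 2 = if oddz t then 1%zz else 0%zz.
  rewrite /oddz; have := Z.mod_pos_bound (Z_of_int t) 2 ltac:(done).
  by have := Z.div_mod (Z_of_int t) 2 ltac:(done); case: eqP; lia.
have symI_eq x y a c : (x, y, a, c) \in quads p -> typeI x y a c ->
    val (symI TI) x y a c = val (symI (flowI F1 F2 F3 F4 F5 F6)) x y a c + val (symI bd) x y a c.
  move=> qs tI; have pos := posP _ _ _ _ qs.
  move: qs tI; rewrite mem_quads => /and5P[x0 y0 a0 c0 /eqP eq_p] /and4P[xo yo ae co].
  have hx : Z.modulo (Z_of_int x) 2 = 1%zz by rewrite mod2 xo.
  have hy : Z.modulo (Z_of_int y) 2 = 1%zz by rewrite mod2 yo.
  have ha : Z.modulo (Z_of_int a) 2 = 0%zz by rewrite mod2 (negbTE ae).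
  have hc : Z.modulo (Z_of_int c) 2 = 1%zz by rewrite mod2 co.
  have van := all_resP _ _ (pt x y a c) balI hx hy ha hc.
  have a2 : 1 < a by move: ae; rewrite /oddz; lia.
  (* Here [x (y + a) = p] with [y + a > 1], so [x = 1], and both inequalities follow. *)
  have xc : x = c -> x < a /\ x <= y.
    move=> eq_xc; have [||x1|] := @prime_factorz p x (y + a) p_pr x0; [lia | | lia | lia].
    by rewrite -eq_p -eq_xc; ring.
  have yc : y = c -> y < a /\ y <= x.
    move=> eq_yc; have [||y1|] := @prime_factorz p y (x + a) p_pr y0; [lia | | lia | lia].
    by rewrite -eq_p -eq_yc; ring.
  have H := guardI_sound xc yc (vanishes_sound pos (resP _) van).
  have {}H : Z.add (valz (symI TI) (pt x y a c)) (Z.mul (-1)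
    (Z.add (valz (symI (flowI F1 F2 F3 F4 F5 F6)) (pt x y a c)) (valz (symI bd) (pt x y a c)))) = 0%zz := H.
  by rewrite /val; lia.
have symII_eq x y a c : (x, y, a, c) \in quads p -> typeII x y a c ->
    val (symII TII) x y a c = val (symII (flowII F3 F4 F5 F6)) x y a c.
  move=> qs tI; have pos := posP _ _ _ _ qs.
  move: qs tI; rewrite mem_quads => /and5P[x0 y0 a0 c0 /eqP eq_p] /and4P[xo yo ae ce].
  have hx : Z.modulo (Z_of_int x) 2 = 1%zz by rewrite mod2 xo.
  have hy : Z.modulo (Z_of_int y) 2 = 1%zz by rewrite mod2 yo.
  have ha : Z.modulo (Z_of_int a) 2 = 0%zz by rewrite mod2 (negbTE ae).
  have hc : Z.modulo (Z_of_int c) 2 = 0%zz by rewrite mod2 (negbTE ce).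
  have van := all_resP _ _ (pt x y a c) balII hx hy ha hc.
  (* With [c = a + 2 x] the equation would read [p = (x + a)^2]; the other three cases give squares
     in the same way. *)
  have xy : x = y -> c <> a + 2 * x /\ a <> c + 2 * x.
    move=> eq_xy; split=> eq_ac; have [] := @prime_not_square p (if c < a then x + c else x + a) p_pr.
    - by rewrite -eq_p eq_ac -eq_xy ifF; [ring | lia].
    - by rewrite -eq_p eq_ac -eq_xy ifT; [ring | lia].
  have ac : a = c -> y <> x + 2 * a /\ x <> y + 2 * a.
    move=> eq_ac; split=> eq_xy; have [] := @prime_not_square p (if x < y then x + a else y + a) p_pr.
    - by rewrite -eq_p -eq_ac eq_xy ifT; [ring | lia].
    - by rewrite -eq_p -eq_ac eq_xy ifF; [ring | lia].
  have H := guardII_sound xy ac (vanishes_sound pos (resP _) van).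
  have {}H : Z.add (valz (symII TII) (pt x y a c)) (Z.mul (-1)
    (valz (symII (flowII F3 F4 F5 F6)) (pt x y a c))) = 0%zz := H.
  by rewrite /val; lia.
have sum_symI F : sumq p typeI (val (symI F)) = sumq p typeI (val F) *+ 2.
  rewrite (eq_sumq (fun x y a c _ _ => val_symI F x y a c)) sumqD mulr2n; congr (_ + _).
  exact/esym/sumI_swap.
have sum_symII F : sumq p typeII (val (symII F)) = sumq p typeII (val F) *+ 4.
  rewrite (eq_sumq (fun x y a c _ _ => val_symII F x y a c)) sumqD.
  rewrite -(@sumII_swapr _ p (val (symI F))) -mulr2n (mulrnA _ 2 2); congr (_ *+ 2).
  rewrite (eq_sumq (fun x y a c _ _ => val_symI F x y a c)) sumqD mulr2n; congr (_ + _).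
  exact/esym/sumII_swapl.
have := flow_balance p F1 F2 F3 F4 F5 F6.
have := eq_sumq symI_eq; have := eq_sumq symII_eq.
rewrite sumqD !sum_symI !sum_symII; lia.
Qed.

(** * Boundary terms *)

(** On the wall [x = c = 1] and [y + a = p], so the solutions are indexed by the odd numbers
    [y = 2 m + 1] below [p]. *)
Lemma sumI_boundary (p : nat) (F : int -> int -> int -> int -> int) :
  prime p -> odd p ->
  sumq p typeI (fun x y a c => if x == c then F x y a c else 0) =
  \sum_(0 <= m < p./2) F 1 (2 * m%:Z + 1) (p%:Z - 1 - 2 * m%:Z) 1.
Proof.
move=> p_pr p_odd; rewrite sumq_if /sumq.
pose h (m : nat) : int * int * int * int := (1, 2 * m%:Z + 1, p%:Z - 1 - 2 * m%:Z, 1).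
pose g (q : int * int * int * int) : nat := let: (x, y, a, c) := q in (`|y|./2)%N.
rewrite (@big_reindex_cond _ _ _ (index_iota 0 p./2) (quads p) xpredT _ h g) ?iota_uniq ?uniq_quads //.
- move=> m; rewrite mem_iota => mlt _; rewrite mem_quads /typeI /oddz /g /=.
  by split; [lia|lia|lia].
- move=> [[[x y] a] c]; rewrite mem_quads => /and5P[x0 y0 a0 c0 /eqP eq_p].
  rewrite /typeI /oddz /= => /andP[/and4P[xo yo ae co] /eqP xc].
  have x1 : x = 1.
    have [||//|] := @prime_factorz p x (y + a) p_pr x0; [lia | | lia].
    by rewrite -eq_p xc; ring.
  by rewrite mem_iota /h; split; [lia | by [] | congr (_, _, _, _); lia].
Qed.

Lemma val_bd_off F x y a c : val (fun r => If0 (vx - vc) (F r) (Cst 0)) x y a c =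
  if x == c then val F x y a c else 0.
Proof.
rewrite /val /valz eval_If0 (_ : Z.eqb _ _ = (x == c)); first by case: (x == c).
by rewrite /lval /=; lia.
Qed.

Lemma sum_bdB (p : nat) : prime p -> odd p -> sumq p typeI (val bdB) = 16 * (p%:Z - 1).
Proof.
move=> p_pr p_odd; rewrite (eq_sumq (fun x y a c _ _ => val_bd_off (fun=> Cst 32) x y a c)).
by rewrite sumI_boundary // (eq_bigr (fun=> 32)) // sumr_const_nat; lia.
Qed.

Lemma sum_bdE (p : nat) : prime p -> odd p -> sumq p typeI (val bdE) = 16 * (4 * p%:Z - 7).
Proof.
move=> p_pr p_odd; pose F : rfun := fun=> (Cst 128 - If0 (vy - vc) (Cst 48) (Cst 0))%pw.
rewrite (eq_sumq (fun x y a c _ _ => val_bd_off F x y a c)).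
(* [y = c = 1] happens only for [m = 0], where the value drops to [128 - 48 = 80]. *)
have valF m : val F 1 (2 * m%:Z + 1) (p%:Z - 1 - 2 * m%:Z) 1 = if m == 0 then 80 else 128.
  rewrite /val (_ : valz _ _ = if Z.eqb (lval (pt 1 (2 * m%:Z + 1) (p%:Z - 1 - 2 * m%:Z) 1) (vy - vc)%lin) 0
    then 80%zz else 128%zz).
    by rewrite /lval /=; case: Z.eqb_spec; case: eqP; lia.
  rewrite [LHS](_ : _ = Z.add 128 (Z.mul (-1) (eval (pt 1 (2 * m%:Z + 1) (p%:Z - 1 - 2 * m%:Z) 1)
    (If0 (vy - vc) (Cst 48) (Cst 0))))) // eval_If0.
  by case: Z.eqb.
have p2 := prime_gt1 p_pr; rewrite sumI_boundary // big_ltn ?valF; last lia.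
rewrite (eq_big_nat _ _ (F2 := fun=> 128)) => [|m /andP[m0 _]]; last first.
  by rewrite valF ifF //; lia.
by rewrite sumr_const_nat /=; lia.
Qed.

Lemma sum_parity n (u v : int) :
  \sum_(0 <= m < n) (if odd m then u else v) = u * (n./2)%:Z + v * (uphalf n)%:Z.
Proof.
elim: n => [|n IHn]; first by rewrite big_geq // !mulr0.
rewrite big_nat_recr //= {}IHn uphalf_half; have intS1 k : (k.+1)%:Z = k%:Z + 1 by lia.
by case: (odd n); rewrite /= ?add1n ?add0n ?intS1; ring.
Qed.

(** Along the wall the residues depend only on [p] and on the parity of [m]. If [p] is 1 modulo 4,
    the values alternate between -16 and 48 over an even number of terms. If [p] is 3 modulo 4, they
    alternate between 32 and 0, except that the term [m = 0] is cancelled by the correction at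
    [y = c]. *)
Lemma sum_bdC (p : nat) : prime p -> odd p ->
  sumq p typeI (val bdC) = if (p %% 4 == 1)%N then 8 * (p%:Z - 1) else 8 * (p%:Z - 3).
Proof.
move=> p_pr p_odd; pose F : rfun := fun r => (at4 1 1 0 1 r (Cst (-16)) + at4 1 3 2 1 r (Cst 48)
  + at4 1 1 2 1 r (Cst 32) - If0 (vy - vc) (at4 1 1 2 1 r (Cst 32)) (Cst 0))%pw.
rewrite (eq_sumq (fun x y a c _ _ => val_bd_off F x y a c)) sumI_boundary //.
have p2 := prime_gt1 p_pr.
have rE m : rmod (pt 1 (2 * m%:Z + 1) (p%:Z - 1 - 2 * m%:Z) 1) =
   Lin 1 (if odd m then 3%zz else 1%zz) (if odd m (+) (p %% 4 == 1)%N then 0%zz else 2%zz) 1.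
  have [k pk] : exists k, p = (4 * k + if p %% 4 == 1 then 1 else 3)%N.
    exists (p %/ 4)%N; move: (divn_eq p 4) (ltn_pmod p (isT : 0 < 4)%N); case: ifP => /eqP; lia.
  have mk : m = (2 * m./2 + odd m)%N by lia.
  move: mk pk; move: (m./2) (odd m) (p %% 4 == 1)%N => j b d -> ->.
  rewrite /rmod /pt [lx _]/= [ly _]/= [la _]/= [lc _]/=.
  have mod4 (t q e : Z) : t = Z.add e (Z.mul q 4) -> Z.modulo t 4 = Z.modulo e 4.
    by move=> ->; rewrite Z.mod_add.
  by congr Lin; [rewrite (mod4 _ (Z.of_nat j) (if b then 3%zz else 1%zz)) | 
    rewrite (mod4 _ (Z.sub (Z.of_nat k) (Z.of_nat j)) (if b (+) d then 0%zz else if b then (-2)%zz else 2%zz))];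
    case: b; case: d => //=; lia.
have valF m : val F 1 (2 * m%:Z + 1) (p%:Z - 1 - 2 * m%:Z) 1 =
    if (p %% 4 == 1)%N then if odd m then 48 else -16
    else if odd m then 0 else if m == 0 then 0 else 32.
  rewrite /val /valz rE; set v := pt _ _ _ _.
  have FE r : eval v (F r) = Z.add (eval v (at4 1 1 0 1 r (Cst (-16)) + at4 1 3 2 1 r (Cst 48)
      + at4 1 1 2 1 r (Cst 32))%pw) (Z.mul (-1) (if m == 0 then eval v (at4 1 1 2 1 r (Cst 32)) else 0%zz)).
    rewrite [LHS](_ : _ = Z.add (eval v (at4 1 1 0 1 r (Cst (-16)) + at4 1 3 2 1 r (Cst 48)
      + at4 1 1 2 1 r (Cst 32))%pw) (Z.mul (-1) (eval v (If0 (vy - vc) (at4 1 1 2 1 r (Cst 32)) (Cst 0))))) //.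
    rewrite eval_If0 (_ : Z.eqb _ _ = (m == 0)); first by case: (m == 0).
    by rewrite /v /lval /=; lia.
  rewrite FE; case: (odd m); case: (p %% 4 == 1)%N; case: (m == 0) => //.
rewrite (eq_bigr _ (fun m _ => valF m)).
case: ifP => /eqP p1.
  by rewrite sum_parity; lia.
have p0 : (0 < p./2)%N by lia.
rewrite big_ltn // [X in _ + X](eq_big_nat _ _ (F2 := fun m => if odd m then 0 else 32)).
  have H := sum_parity p./2 0 32; rewrite big_ltn //= in H.
  have p3 : uphalf p./2 = ((p - 3) %/ 4 + 1)%N by lia.
  move: H; rewrite p3; set s1 := bigop.body _ _ _. lia.
by move=> [|m].
Qed.

(** * Reduced forms *)

Definition qval (f : form) (x y : int) : int := fa f * x ^+ 2 + fb f * x * y + fc f * y ^+ 2.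

Lemma sl2_equiv_refl f : sl2_equiv f f.
Proof.
by exists 1, 0, 0, 1; split=> //; case: f => -[a b] c; rewrite /act /fa /fb /fc /=;
  congr (_, _, _); ring.
Qed.

Lemma sl2_equiv_trans f g h : sl2_equiv f g -> sl2_equiv g h -> sl2_equiv f h.
Proof.
move=> [al [be [ga [de [det1 <-]]]]] [al' [be' [ga' [de' [det2 <-]]]]].
exists (al * al' + be * ga'), (al * be' + be * de'), (ga * al' + de * ga'), (ga * be' + de * de').
split; first by rewrite -[RHS]mulr1 -{1}det1 -[X in _ = _ * X]det2; ring.
by case: f => -[a b] c; rewrite /act /fa /fb /fc /=; congr (_, _, _); ring.
Qed.

Lemma act_inv f al be ga de :
  al * de - be * ga = 1 -> act (act f al be ga de) de (- be) (- ga) al = f.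
Proof.
move=> det1; case: f => -[a b] c; rewrite /act /fa /fb /fc /=.
have det2 : (al * de - be * ga) ^+ 2 = 1 by rewrite det1.
congr (_, _, _).
- by rewrite -[RHS]mulr1 -[X in _ = _ * X]det2; ring.
- by rewrite -[RHS]mulr1 -[X in _ = _ * X]det2; ring.
- by rewrite -[RHS]mulr1 -[X in _ = _ * X]det2; ring.
Qed.

Lemma sl2_equiv_sym f g : sl2_equiv f g -> sl2_equiv g f.
Proof.
move=> [al [be [ga [de [det1 <-]]]]]; exists de, (- be), (- ga), al.
by split; [rewrite -det1; ring | exact: act_inv].
Qed.

Lemma disc_equiv f g : sl2_equiv f g -> disc g = disc f.
Proof.
move=> [al [be [ga [de [det1 <-]]]]].
have det2 : (al * de - be * ga) ^+ 2 = 1 by rewrite det1.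
by rewrite -[RHS]mulr1 -[X in _ = _ * X]det2 /disc /act /fa /fb /fc /=; ring.
Qed.

Lemma qval_pos f x y : pos_def f -> (x != 0) || (y != 0) -> 0 < qval f x y.
Proof.
case: f => -[a b] c; rewrite /pos_def /disc /qval /fa /fb /fc /= => -[a0 D0] xy0.
have sq : 4 * a * (a * x ^+ 2 + b * x * y + c * y ^+ 2) =
  (2 * a * x + b * y) ^+ 2 - (b ^+ 2 - 4 * a * c) * y ^+ 2 by ring.
suff : 0 < 4 * a * (a * x ^+ 2 + b * x * y + c * y ^+ 2) by rewrite pmulr_rgt0 //; lia.
rewrite sq; have [y0|y0] := eqVneq y 0.
  move: xy0; rewrite y0 eqxx orbF => x0; rewrite mulr0 addr0 expr0n /= mulr0 subr0.
  by rewrite exprn_even_gt0 //= mulf_neq0 // mulf_neq0 //; lia.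
rewrite ltr_wpDl ?sqr_ge0 // -mulNr mulr_gt0 ?oppr_gt0 // exprn_even_gt0 //=.
Qed.

Lemma pos_def_equiv f g : sl2_equiv f g -> pos_def f -> pos_def g.
Proof.
move=> eq_fg fP; split; last by rewrite (disc_equiv eq_fg); case: fP.
case: eq_fg => al [be [ga [de [det1 <-]]]]; rewrite /act /fa /=.
apply: (qval_pos fP); rewrite -negb_and; apply/negP => /andP[/eqP al0 /eqP ga0].
by move: det1; rewrite al0 ga0; lia.
Qed.

Lemma equiv_shift a b c k : sl2_equiv (a, b, c) (a, b + 2 * a * k, a * k ^+ 2 + b * k + c).
Proof.
by exists 1, k, 0, 1; split; [lia | rewrite /act /fa /fb /fc /=; congr (_, _, _); ring].
Qed.

Lemma equiv_flip a b c : sl2_equiv (a, b, c) (c, - b, a).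
Proof.
by exists 0, (-1), 1, 0; split; [lia | rewrite /act /fa /fb /fc /=; congr (_, _, _); ring].
Qed.

Definition reduced (f : form) : bool :=
  [&& - fa f < fb f, fb f <= fa f, fa f <= fc f & (fa f == fc f) ==> (0 <= fb f)].

(** Gauss reduction: a translation brings [b] into the half-open window, and if then [c < a], the
    flip produces a smaller leading coefficient, on which the induction runs. *)
Lemma reduced_exists f : pos_def f -> exists2 g, reduced g & sl2_equiv f g.
Proof.
have [n] := ubnP `|fa f|%N; elim: n f => // n IHn [[a b] c] lt_an fP.
have a0 : 0 < a by case: fP.
(* With the offset [a - 1] the remainder modulo [2 a] is [b' + a - 1], and its range from 0 to
   [2 a - 1] is exactly [- a < b' <= a]. *)
pose k := - ((b + a - 1) %/ (2 * a))%Z.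
pose b' := b + 2 * a * k; pose c' := a * k ^+ 2 + b * k + c.
have eq1 : sl2_equiv (a, b, c) (a, b', c') := equiv_shift a b c k.
have [b'l b'r] : - a < b' /\ b' <= a.
  have := divz_eq (b + a - 1) (2 * a); have := modz_ge0 (b + a - 1) (d := 2 * a).
  have := ltz_pmod (b + a - 1) (d := 2 * a).
  by rewrite /b' /k; move: (_ %/ _)%Z (_ %% _)%Z => q m; lia.
have gP := pos_def_equiv eq1 fP.
have [lt_ac|lt_ca|eq_ac] := ltrgtP a c'.
- by exists (a, b', c') => //; rewrite /reduced /fa /fb /fc /= b'l b'r ltW // lt_eqF.
- have eq2 := sl2_equiv_trans eq1 (equiv_flip a b' c').
  have hP := pos_def_equiv eq2 fP.
  have [|g gred eq3] := IHn (c', - b', a) _ hP.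
    by case: hP; move: lt_an; rewrite /fa /=; lia.
  by exists g => //; exact: sl2_equiv_trans eq2 eq3.
- have [b'0|b'0] := lerP 0 b'.
    by exists (a, b', c') => //; rewrite /reduced /fa /fb /fc /= b'l b'r eq_ac lexx b'0 implybT.
  (* With equal outer coefficients the flip only changes the sign of the middle one, as the
     convention for [a = c] requires. *)
  exists (c', - b', a); last exact: sl2_equiv_trans eq1 (equiv_flip a b' c').
  by rewrite /reduced /fa /fb /fc /= eq_ac; lia.
Qed.

(** Put [u = |x|] and [v = |y| >= 1]. Since [|b| <= a], the value is at least
    [a u^2 - a u v + c v^2]. If [v <= u], the first two terms have a nonnegative sum; if [u < v],
    then [a <= c] bounds the whole below by [c v (v - u) >= c]. *)
Lemma reduced_qval f x y : reduced f -> pos_def f -> y != 0 -> fc f <= qval f x y.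
Proof.
case: f => -[a b] c; rewrite /reduced /pos_def /qval /fa /fb /fc /= => /and4P[bl br ac _] [a0 _] y0.
have nbxy : `|b * x * y| <= a * `|x| * `|y| by rewrite !normrM !ler_wpM2r //; lia.
have bxy : - (a * `|x| * `|y|) <= b * x * y by move: nbxy; rewrite ler_norml => /andP[].
have -> : x ^+ 2 = `|x| ^+ 2 by rewrite real_normK ?num_real.
have -> : y ^+ 2 = `|y| ^+ 2 by rewrite real_normK ?num_real.
have x1 : 0 <= `|x| := normr_ge0 x; have y1 : 1 <= `|y| by lia.
move: bxy x1 y1; clear nbxy; move: `|x| `|y| (b * x * y) => u v w ? ? ?.
have c0 : 0 < c by lia.
have [le_vu|lt_uv] := lerP v u.
  have : 0 <= a * (u * (u - v)) by rewrite !mulr_ge0; lia.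
  have : 0 <= c * ((v - 1) * (v + 1)) by rewrite !mulr_ge0; lia.
  by lia.
have : 0 <= a * (u * u) by rewrite !mulr_ge0; lia.
have : 0 <= (c - a) * (u * v) by rewrite !mulr_ge0; lia.
have : 0 <= c * (v * (v - u - 1)) by rewrite !mulr_ge0; lia.
have : 0 <= c * (v - 1) by rewrite !mulr_ge0; lia.
by lia.
Qed.

Lemma reduced_fa_le f x y : reduced f -> pos_def f -> (x != 0) || (y != 0) -> fa f <= qval f x y.
Proof.
move=> fred fP; have [->|y0 _] := eqVneq y 0; last first.
  by apply: le_trans (reduced_qval x fred fP y0); case/and4P: fred.
rewrite orbF => x0; rewrite /qval mulr0 addr0 expr0n /= mulr0 addr0.
have x2 : 0 < x ^+ 2 by rewrite exprn_even_gt0.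
have [a0 _] := fP; rewrite -[leLHS]mulr1 ler_pM2l //; move: x2; move: (x ^+ 2) => z; lia.
Qed.

(** The leading coefficient is the minimum of the form, so the two agree. If [ga = 0] the matrix is
    a translation up to sign, and the window of length [2 a] pins [b]. Otherwise the minimum is
    attained with nonzero second argument, which forces [c = a] for both forms; then [b] is
    nonnegative and determined by the discriminant. *)
Lemma reduced_uniq f g : reduced f -> reduced g -> pos_def f -> sl2_equiv f g -> f = g.
Proof.
move=> fred gred fP eq_fg; have gP := pos_def_equiv eq_fg fP.
have eqD := disc_equiv eq_fg; have eq_gf := sl2_equiv_sym eq_fg.
have le_a h h' : reduced h -> pos_def h -> sl2_equiv h h' -> fa h <= fa h'.
  move=> hred hP [al [be [ga [de [det1 <-]]]]]; apply: (reduced_fa_le hred hP).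
  by rewrite -negb_and; apply/negP => /andP[/eqP al0 /eqP ga0]; move: det1; rewrite al0 ga0; lia.
have eq_a : fa f = fa g by apply/eqP; rewrite eq_le !le_a.
have le_c h h' al be ga de : reduced h -> pos_def h -> al * de - be * ga = 1 ->
    act h al be ga de = h' -> ga != 0 -> fc h <= fa h'.
  by move=> hred hP _ <- ga0; exact: reduced_qval.
have [al [be [ga [de [det1 act_g]]]]] := eq_fg.
have act_f : act g de (- be) (- ga) al = f by rewrite -act_g act_inv.
move: fred gred fP gP eqD eq_a act_g act_f le_c {eq_fg eq_gf le_a}.
case: f => -[a b] c; case: g => -[a' b'] c'.
rewrite /reduced /pos_def /disc /fa /fb /fc /=.
move=> fred gred [a0 D0] [a0' D0'] eqD eq_a act_g act_f le_c; subst a'.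
have [ga0|ga0] := eqVneq ga 0.
  have eq_b : b' = b + 2 * a * (al * be).
    have ad1 : al * de = 1 by move: det1; rewrite ga0; lia.
    case: act_g => _ <- _; rewrite ga0 /fa /fb /=.
    have -> : b + 2 * a * (al * be) = b * 1 + 2 * a * (al * be) by rewrite mulr1.
    by rewrite -[X in _ = b * X + _]ad1; ring.
  have eq_bb : b' = b.
    move: eq_b; move: (al * be) => k eq_b; case/and4P: fred gred => ? ? _ _ /and4P[? ? _ _].
    have [k0|k0|k0] := ltrgtP k 0; last by rewrite eq_b k0; lia.
      have : 0 <= a * (- 1 - k) by rewrite mulr_ge0; lia.
      by lia.
    have : 0 <= a * (k - 1) by rewrite mulr_ge0; lia.
    by lia.
  by subst b'; congr (_, _, _); nia.
have le_ca : c <= a := le_c (a, b, c) (a, b', c') al be ga de fred (conj a0 D0) det1 act_g ga0.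
have det1' : de * al - - be * - ga = 1 by rewrite -det1; ring.
have ga0' : - ga != 0 by rewrite oppr_eq0.
have le_ca' : c' <= a := le_c (a, b', c') (a, b, c) de (- be) (- ga) al gred (conj a0' D0') det1' act_f ga0'.
have [ec ec'] : c = a /\ c' = a by case/and4P: fred gred => ? ? ? _ /and4P[_ _ ? _]; lia.
subst c c'; have [b0 b0'] : 0 <= b /\ 0 <= b' by case/and4P: fred gred => _ _ _; rewrite eqxx /= => -> /and4P[_ _ _ ->].
by congr (_, _, _); nia.
Qed.

Lemma equiv_kk_reduced f g : pos_def f -> reduced g -> sl2_equiv f g ->
  (exists k : int, sl2_equiv f (k, 0, k)) <-> (fb g = 0 /\ fa g = fc g).
Proof.
move=> fP gred eq_fg; split=> [[k eq_k]|[b0 eq_ac]]; last first.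
  by exists (fa g); move: b0 eq_ac eq_fg; case: g {gred} => -[a b] c; rewrite /fa /fb /fc /= => -> <-.
have kP := pos_def_equiv eq_k fP; have k0 : 0 < k by case: kP.
have kred : reduced (k, 0, k) by rewrite /reduced /fa /fb /fc /=; lia.
have := sl2_equiv_trans (sl2_equiv_sym eq_fg) eq_k => /(reduced_uniq gred kred).
by move=> -> //; exact: pos_def_equiv fP.
Qed.

Lemma equiv_kkk_reduced f g : pos_def f -> reduced g -> sl2_equiv f g ->
  (exists k : int, sl2_equiv f (k, k, k)) <-> (fb g = fa g /\ fa g = fc g).
Proof.
move=> fP gred eq_fg; split=> [[k eq_k]|[eq_ab eq_ac]]; last first.
  by exists (fa g); move: eq_ab eq_ac eq_fg; case: g {gred} => -[a b] c; rewrite /fa /fb /fc /= => -> <-.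
have kP := pos_def_equiv eq_k fP; have k0 : 0 < k by case: kP.
have kred : reduced (k, k, k) by rewrite /reduced /fa /fb /fc /=; lia.
have := sl2_equiv_trans (sl2_equiv_sym eq_fg) eq_k => /(reduced_uniq gred kred).
by move=> -> //; exact: pos_def_equiv fP.
Qed.

(** * Enumeration of the reduced forms and independence of the representatives *)

Definition sym_range (n : nat) : seq int := [seq i%:Z - n%:Z | i <- iota 0 (2 * n).+1].

Lemma mem_sym_range n (x : int) : (x \in sym_range n) = (- n%:Z <= x <= n%:Z).
Proof.
apply/mapP/idP => [[i]|/andP[x0 xn]]; first by rewrite mem_iota => ? ->; lia.
by exists `|(x + n%:Z)%R|%N; rewrite ?mem_iota; lia.
Qed.

Lemma uniq_sym_range n : uniq (sym_range n).
Proof. by rewrite map_inj_in_uniq ?iota_uniq // => i j _ _; lia. Qed.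

Lemma mem_triple (A B C : eqType) (r : seq A) (s : seq B) (t : seq C) x y z :
  ((x, y, z) \in [seq (u, w) | u <- [seq (v, w) | v <- r, w <- s], w <- t]) =
  [&& x \in r, y \in s & z \in t].
Proof.
apply/allpairsP/and3P => [[[u w] [/= /allpairsP [[v v'] [/= vr v's ->]] wt [-> -> ->]]] //|[xr ys zt]].
by exists ((x, y), z); split=> //; apply/allpairsP; exists (x, y).
Qed.

Lemma uniq_triple (A B C : eqType) (r : seq A) (s : seq B) (t : seq C) :
  uniq r -> uniq s -> uniq t ->
  uniq [seq (u, w) | u <- [seq (v, w) | v <- r, w <- s], w <- t].
Proof.
move=> ur us ut; apply: allpairs_uniq => //; last by move=> [? ?] [? ?] _ _ [-> ->].
by apply: allpairs_uniq => // -[? ?] [? ?] _ _ [-> ->].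
Qed.

Definition reduced_forms (N : nat) : seq form :=
  [seq f <- [seq (u, c) | u <- [seq (a, b) | a <- zrange N, b <- sym_range N], c <- zrange N]
     | [&& 0 < fa f, reduced f & disc f == - N%:Z]].

Lemma uniq_reduced_forms N : uniq (reduced_forms N).
Proof. by apply/filter_uniq/uniq_triple; rewrite ?uniq_zrange ?uniq_sym_range. Qed.

(** From [b^2 <= a^2 <= a c] one gets [N >= 3 a c], so the enumerated box contains every reduced
    form. *)
Lemma mem_reduced_forms N f :
  (f \in reduced_forms N) = [&& 0 < fa f, reduced f & disc f == - N%:Z].
Proof.
rewrite mem_filter; apply: andb_idr; case: f => -[a b] c.
rewrite /reduced /disc /fa /fb /fc /= => /and3P[a0 /and4P[bl br ac _] /eqP D].
have -> := mem_triple (zrange N) (sym_range N) (zrange N) a b c.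
rewrite !mem_zrange mem_sym_range.
have : 0 <= a * (c - a) by rewrite mulr_ge0; lia.
have : 0 <= (a - b) * (a + b) by rewrite mulr_ge0; lia.
have : 0 <= a * (a - 1) by rewrite mulr_ge0; lia.
have : 0 <= (a - 1) * (c - 1) by rewrite mulr_ge0; lia.
by move: D; rewrite expr2; lia.
Qed.

Definition reduced_weight (g : form) : rat :=
  if (fb g == 0) && (fa g == fc g) then 1 / 2
  else if (fb g == fa g) && (fa g == fc g) then 1 / 3 else 1.

Lemma class_weight_reduced f g :
  pos_def f -> reduced g -> sl2_equiv f g -> class_weight f = reduced_weight g.
Proof.
move=> fP gred eq_fg; rewrite /class_weight /reduced_weight.
have kkP := equiv_kk_reduced fP gred eq_fg; have kkkP := equiv_kkk_reduced fP gred eq_fg.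
case: excluded_middle_informative => [kk|nkk]; first by have [-> ->] := kkP.1 kk; rewrite !eqxx.
rewrite [RHS]ifF; last by apply: contra_notF nkk => /andP[/eqP b0 /eqP eq_ac]; apply/kkP.
case: excluded_middle_informative => [kkk|nkkk]; first by have [-> ->] := kkkP.1 kkk; rewrite !eqxx.
by rewrite [RHS]ifF //; apply: contra_notF nkkk => /andP[/eqP eq_ab /eqP eq_ac]; apply/kkkP.
Qed.

Lemma rep_system_reduced N : (0 < N)%N -> rep_system N (reduced_forms N).
Proof.
move=> N0; split.
  by move=> f; rewrite mem_reduced_forms /pos_def => /and3P[a0 _ /eqP ->]; split=> //; split=> //; lia.
split=> [i j ilt jlt neq_ij eq_ij|f fP Df].
  have /and3P[a0 red_i /eqP D_i] := (etrans (esym (mem_reduced_forms _ _)) (mem_nth (0, 0, 0) ilt)).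
  have /and3P[_ red_j _] := (etrans (esym (mem_reduced_forms _ _)) (mem_nth (0, 0, 0) jlt)).
  have P_i : pos_def (nth (0, 0, 0) (reduced_forms N) i) by split=> //; rewrite D_i; lia.
  apply: neq_ij; apply/eqP; rewrite -(nth_uniq (0, 0, 0) ilt jlt) ?uniq_reduced_forms //.
  exact/eqP/reduced_uniq.
have [g gred eq_fg] := reduced_exists fP.
exists g => //; rewrite mem_reduced_forms gred (disc_equiv eq_fg) Df eqxx andbT.
by have [->] := pos_def_equiv eq_fg fP.
Qed.

(** The definition sums over an unspecified system of representatives. Sending each member to its
    reduced form is a bijection onto [reduced_forms N], and it respects the weights because they are
    class invariants. *)
Lemma hurwitz_reduced N : (0 < N)%N ->
  hurwitz N = \sum_(g <- reduced_forms N) reduced_weight g.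
Proof.
move=> N0; rewrite /hurwitz -[N == 0%N]negbK -lt0n N0 /=.
case: excluded_middle_informative => [exS|]; last by case; exists (reduced_forms N); exact: rep_system_reduced.
case: (constructive_indefinite_description _ exS) => S [SP [Sinj Ssurj]] /=.
pose redP f := exists g, g \in reduced_forms N /\ sl2_equiv f g.
pose h f := if excluded_middle_informative (redP f) is left e
  then proj1_sig (constructive_indefinite_description _ e) else f.
have hP f : f \in S -> h f \in reduced_forms N /\ sl2_equiv f (h f).
  move=> fS; rewrite /h; case: excluded_middle_informative => [e|]; last first.
    by case; have [_ [_ /(_ f)]] := rep_system_reduced N0; case: (SP f fS) => fP Df /(_ fP Df) [g gR ?]; exists g.
  by case: constructive_indefinite_description.
have Suniq : uniq S.
  apply/(uniqP (0, 0, 0)) => i j; rewrite !inE => ilt jlt eq_ij; apply/eqP/negPn/negP => /eqP neq_ij.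
  by apply: (Sinj i j ilt jlt neq_ij); rewrite eq_ij; exact: sl2_equiv_refl.
rewrite [RHS](@big_reindex_mem _ _ _ S _ h) ?uniq_reduced_forms //.
- rewrite [LHS]big_seq [RHS]big_seq; apply: eq_bigr => f fS.
  have [hR eq_fh] := hP f fS; apply: class_weight_reduced => //; first by case: (SP f fS).
  by move: hR; rewrite mem_reduced_forms => /and3P[].
- move=> f f' fS f'S eq_h; have [_ eq_f] := hP f fS; have [_ eq_f'] := hP f' f'S.
  have eq_ff' : sl2_equiv f f' by apply: sl2_equiv_trans eq_f _; rewrite eq_h; exact: sl2_equiv_sym.
  apply/eqP/negPn/negP => neq_ff'; move: (fS) (f'S); rewrite -!index_mem => ilt i'lt.
  apply: (Sinj _ _ ilt i'lt); last by rewrite !nth_index.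
  by move=> eq_i; case/eqP: neq_ff'; rewrite -(nth_index (0, 0, 0) fS) eq_i nth_index.
- by move=> f /hP [].
- move=> g; rewrite mem_reduced_forms => /and3P[a0 gred /eqP Dg].
  have gP : pos_def g by split=> //; rewrite Dg; lia.
  have [f fS eq_gf] := Ssurj g gP Dg; exists f => //.
  have [hR eq_fh] := hP f fS; apply: (reduced_uniq gred) => //.
    by move: hR; rewrite mem_reduced_forms => /and3P[].
  exact: sl2_equiv_trans eq_gf eq_fh.
Qed.

(** * Class numbers as weighted counts of triples *)

Definition same_parity (x y : int) : bool := (x %% 2)%Z == (y %% 2)%Z.

Definition triples (N : nat) : seq (int * int * int) :=
  [seq t <- [seq (u, c) | u <- [seq (a, b) | a <- zrange N, b <- zrange N], c <- zrange N]
     | let: (a, b, c) := t in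
       [&& same_parity a b, same_parity b c & a * b + b * c + c * a == N%:Z]].

Lemma uniq_triples N : uniq (triples N).
Proof. by apply/filter_uniq/uniq_triple; exact: uniq_zrange. Qed.

Lemma mem_triples N a b c : (0 < N)%N ->
  ((a, b, c) \in triples N) = [&& [&& 0 <= a, 0 <= b & 0 <= c],
    same_parity a b, same_parity b c & a * b + b * c + c * a == N%:Z].
Proof.
move=> N0; rewrite mem_filter mem_triple !mem_zrange.
apply/andP/and4P => [[/and3P[ab bc /eqP eqN] ?]|[/and3P[a0 b0 c0] ab bc /eqP eqN]].
  by split=> //; [lia | apply/eqP].
split; first by rewrite ab bc eqN eqxx.
have ab0 : 0 <= a * b by rewrite mulr_ge0.
have bc0 : 0 <= b * c by rewrite mulr_ge0.
have ca0 : 0 <= c * a by rewrite mulr_ge0.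
move: ab bc; rewrite /same_parity => /eqP ab /eqP bc.
have [a1|a1] : a = 0 \/ 1 <= a by lia.
  have b1 : 1 <= b by move: eqN N0; rewrite a1 mul0r mulr0; nia.
  have c1 : 1 <= c by move: eqN N0; rewrite a1 mul0r mulr0; nia.
  by apply/and3P; split; nia.
have [b1|b1] : b = 0 \/ 1 <= b by lia.
  have c1 : 1 <= c by move: eqN N0; rewrite b1; nia.
  by apply/and3P; split; nia.
by apply/and3P; split; nia.
Qed.

(** For [t >= 0] this is the number of integers of absolute value [t], so [twt] counts the choices
    of signs of a triple. *)
Definition hz (t : int) : int := if t == 0 then 1 else 2.
Definition twt (a b c : int) : int := hz a * hz b * hz c.

(* [24] times the weights of the reduced forms with coefficients [(a + c) / 2, +-c, (b + c) / 2]. *)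
Definition sorted_weight (a b c : int) : int :=
  if [&& c <= a & a <= b] then
    if c == 0 then (if a == b then 12 else 24)
    else if (a == b) && (b == c) then 8
    else if (a == b) || (a == c) then 24 else 48
  else 0.

Definition sumt (N : nat) (F : int -> int -> int -> int) : int :=
  \sum_(t <- triples N) let: (a, b, c) := t in F a b c.

Lemma sumt_perm N F : (0 < N)%N ->
  sumt N F = sumt N (fun a b c => F b a c) /\ sumt N F = sumt N (fun a b c => F b c a).
Proof.
move=> N0; split.
- rewrite /sumt [LHS](@big_reindex_cond _ _ _ (triples N) (triples N) xpredT xpredT
    (fun t => (t.1.2, t.1.1, t.2)) (fun t => (t.1.2, t.1.1, t.2))) ?uniq_triples //.
  + by apply: eq_bigr => -[[a b] c].
  + by move=> -[[a b] c]; rewrite /= !mem_triples // /same_parity => ? _; split=> //; lia.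
  + by move=> -[[a b] c]; rewrite /= !mem_triples // /same_parity => ? _; split=> //; lia.
- rewrite /sumt [LHS](@big_reindex_cond _ _ _ (triples N) (triples N) xpredT xpredT
    (fun t => (t.1.2, t.2, t.1.1)) (fun t => (t.2, t.1.1, t.1.2))) ?uniq_triples //.
  + by apply: eq_bigr => -[[a b] c].
  + by move=> -[[a b] c]; rewrite /= !mem_triples // /same_parity => ? _; split=> //; lia.
  + by move=> -[[a b] c]; rewrite /= !mem_triples // /same_parity => ? _; split=> //; lia.
Qed.

Lemma eq_sumt N F G : (0 < N)%N ->
  (forall a b c, 0 <= a -> 0 <= b -> 0 <= c -> same_parity a b -> same_parity b c ->
     a * b + b * c + c * a = N%:Z -> F a b c = G a b c) ->
  sumt N F = sumt N G.
Proof.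
move=> N0 eqFG; rewrite /sumt [LHS]big_seq [RHS]big_seq; apply: eq_bigr => -[[a b] c].
by rewrite mem_triples // => /and4P[/and3P[a0 b0 c0] ? ? /eqP ?]; exact: eqFG.
Qed.

Lemma sumtD N F G : sumt N (fun a b c => F a b c + G a b c) = sumt N F + sumt N G.
Proof. by rewrite /sumt -big_split; apply: eq_bigr => -[[a b] c]. Qed.

(** The sorted weights of the six permutations of a triple add up to [6 * twt]. Since [N > 0], at
    most one of the three variables vanishes, which bounds the number of cases. *)
Lemma sumt_sorted N : (0 < N)%N -> sumt N sorted_weight = sumt N twt.
Proof.
move=> N0; have e1 F := (sumt_perm F N0).1; have e2 F := (sumt_perm F N0).2.
pose w := sorted_weight; pose w1 a b c := w b a c; pose w2 a b c := w b c a.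
pose w3 a b c := w1 b c a; pose w4 a b c := w2 b c a; pose w5 a b c := w3 b c a.
have : sumt N (fun a b c => w a b c + (w1 a b c + (w2 a b c + (w3 a b c + (w4 a b c + w5 a b c))))) =
  sumt N (fun a b c => twt a b c + (twt a b c + (twt a b c + (twt a b c + (twt a b c + twt a b c))))).
  apply: eq_sumt => // a b c a0 b0 c0 _ _ eqN.
  have ab : a != 0 \/ b != 0 by case: (eqVneq a 0) => [za|]; [right; lia | left].
  have bc : b != 0 \/ c != 0 by case: (eqVneq b 0) => [za|]; [right; lia | left].
  have ca : c != 0 \/ a != 0 by case: (eqVneq c 0) => [za|]; [right; lia | left].
  clear eqN; rewrite /w5 /w4 /w3 /w2 /w1 /w /sorted_weight /twt /hz; clear w w1 w2 w3 w4 w5.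
  by case: (ltgtP a b) => ?; case: (ltgtP b c) => ?; case: (ltgtP a c) => ? /=; try lia;
     case: (eqVneq a 0) => ?; case: (eqVneq b 0) => ?; case: (eqVneq c 0) => ? /=; lia.
have q1 : sumt N w1 = sumt N w := esym (e1 w).
have q2 : sumt N w2 = sumt N w := esym (e2 w).
have q3 : sumt N w3 = sumt N w := etrans (esym (e2 w1)) q1.
have q4 : sumt N w4 = sumt N w := etrans (esym (e2 w2)) q2.
have q5 : sumt N w5 = sumt N w := etrans (esym (e2 w3)) q3.
rewrite !sumtD q1 q2 q3 q4 q5 -/w; lia.
Qed.

(** The triple of a reduced form [(A, B, C)] is [(2 A - |B|, 2 C - |B|, |B|)], and its sum of
    products is [4 A C - B^2]. For [B >= 0] reducedness means [c <= a <= b]. For [B < 0] the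
    inequalities are strict, since the conventions exclude [B = - A] and, when [A = C], negative
    [B]. *)
Lemma hurwitz_tri N : (0 < N)%N -> 24 * hurwitz N = (sumt N twt)%:~R.
Proof.
move=> N0; rewrite hurwitz_reduced // -sumt_sorted //.
pose P1 (t : int * int * int) := let: (a, b, c) := t in (c <= a) && (a <= b).
pose P2 (t : int * int * int) := let: (a, b, c) := t in [&& 0 < c, c < a & a < b].
pose h1 (t : int * int * int) : form := let: (a, b, c) := t in (((a + c) %/ 2)%Z, c, ((b + c) %/ 2)%Z).
pose h2 (t : int * int * int) : form := let: (a, b, c) := t in (((a + c) %/ 2)%Z, - c, ((b + c) %/ 2)%Z).
pose g1 (f : form) := (2 * fa f - fb f, 2 * fc f - fb f, fb f).
pose g2 (f : form) := (2 * fa f + fb f, 2 * fc f + fb f, - fb f).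
have disc_h (a b c e : int) : same_parity a b -> same_parity b c -> e = c \/ e = - c ->
    disc (((a + c) %/ 2)%Z, e, ((b + c) %/ 2)%Z) = - (a * b + b * c + c * a).
  rewrite /same_parity /disc /fa /fb /fc /= => ab bc ce.
  have [k ka] : exists k, a = 2 * k - c by exists ((a + c) %/ 2)%Z; lia.
  have [l lb] : exists l, b = 2 * l - c by exists ((b + c) %/ 2)%Z; lia.
  have -> : ((a + c) %/ 2)%Z = k by lia.
  have -> : ((b + c) %/ 2)%Z = l by lia.
  have -> : e ^+ 2 = c ^+ 2 by case: ce => ->; ring.
  by rewrite ka lb; ring.
rewrite (bigID (fun g => 0 <= fb g)) /=.
have c0 (a b c : int) : c <= a -> a <= b -> 0 <= c -> a * b + b * c + c * a = N%:Z -> 0 < a.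
  by move=> ca ab c0 eqN; have : a <> 0 by [move=> a0; move: eqN; rewrite a0 (_ : c = 0); lia]; lia.
rewrite (@big_reindex_cond _ _ _ (triples N) (reduced_forms N) P1 _ h1 g1) ?uniq_triples ?uniq_reduced_forms //; last first.
- move=> [[a b] c]; rewrite mem_reduced_forms /reduced /g1 /h1 /P1 /fa /fb /fc /=.
  move=> /and3P[a0 /and4P[bl br ac bac] /eqP D] b0.
  rewrite mem_triples // /same_parity; split; [|lia|by congr (_, _, _); lia].
  apply/and4P; split; [lia|lia|lia|].
  by apply/eqP; move: D; rewrite /disc /fa /fb /fc /= => D; rewrite -[RHS]opprK -D; ring.
- move=> [[a b] c]; rewrite mem_triples // => /and4P[/and3P[a0 b0 c0'] ab bc /eqP eqN] /andP[ca le_ab].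
  have a1 := c0 a b c ca le_ab c0' eqN.
  rewrite mem_reduced_forms /h1 disc_h ?eqN ?eqxx //; last by left.
  move: ab bc; rewrite /same_parity /reduced /g1 /fa /fb /fc /= => ab bc.
  by split; [lia|lia|congr (_, _, _); lia].
rewrite [X in _ + X](@big_reindex_cond _ _ _ (triples N) (reduced_forms N) P2 _ h2 g2) ?uniq_triples ?uniq_reduced_forms //; last first.
- move=> [[a b] c]; rewrite mem_reduced_forms /reduced /g2 /h2 /P2 /fa /fb /fc /=.
  move=> /and3P[a0 /and4P[bl br ac bac] /eqP D] b0.
  rewrite mem_triples // /same_parity; split; [|lia|by congr (_, _, _); lia].
  apply/and4P; split; [lia|lia|lia|].
  by apply/eqP; move: D; rewrite /disc /fa /fb /fc /= => D; rewrite -[RHS]opprK -D; ring.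
- move=> [[a b] c]; rewrite mem_triples // => /and4P[/and3P[a0 b0 c0'] ab bc /eqP eqN] /and3P[c1 ca lt_ab].
  rewrite mem_reduced_forms /h2 disc_h ?eqN ?eqxx //; last by right.
  move: ab bc; rewrite /same_parity /reduced /g2 /fa /fb /fc /= => ab bc.
  by split; [lia|lia|congr (_, _, _); lia].
rewrite /sumt raddf_sum /= [X in X + _]big_mkcond [X in _ + X]big_mkcond -big_split mulr_sumr.
rewrite [LHS]big_seq [RHS]big_seq; apply: eq_bigr => -[[a b] c].
rewrite mem_triples // => /and4P[/and3P[a0 b0 c0'] ab bc /eqP eqN] /=.
have c1 := c0 a b c; move: ab bc; rewrite /same_parity => ab bc.
rewrite /reduced_weight /sorted_weight /h1 /h2 /fa /fb /fc /=.
have -> : (((a + c) %/ 2)%Z == ((b + c) %/ 2)%Z) = (a == b) by lia.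
have -> : (c == ((a + c) %/ 2)%Z) = (a == c) by lia.
have -> : (- c == ((a + c) %/ 2)%Z) = (a == - (3 * c)) by lia.
have -> : (- c == 0) = (c == 0) by lia.
case: (ltgtP c a) => [lt_ca|?|ec] /=; case: (ltgtP a b) => [lt_ab|?|eb] /=.
all: try by rewrite ?andbF ?mulr0 ?addr0.
- rewrite !andbF !andbT; case: (eqVneq c 0) => [->|nc] /=; first exact/eqP.
  by rewrite ifT; [exact/eqP | lia].
- have -> : (b == c) = false by lia.
  rewrite ?andbF ?andbT.
  by case: (eqVneq c 0) => _ /=; exact/eqP.
- by rewrite !andbF; case: ifP => _; exact/eqP.
- have nc : c != 0 by apply/eqP => z; have := c1 ltac:(lia) ltac:(lia) c0' eqN; lia.
  by rewrite -eb -ec eqxx (negbTE nc) /= !andbF; exact/eqP.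
Qed.

(** * Parity types *)

Lemma oddzD x y : oddz (x + y) = oddz x (+) oddz y.
Proof. by rewrite /oddz; lia. Qed.

Lemma oddzM x y : oddz (x * y) = oddz x && oddz y.
Proof.
rewrite /oddz; have := divz_eq x 2; have := divz_eq y 2.
move: (x %/ 2)%Z (y %/ 2)%Z => k l.
have [->|->] : (y %% 2)%Z = 0 \/ (y %% 2)%Z = 1 by lia.
  by move=> -> _; rewrite (_ : x * _ = 2 * (x * l)); [lia | ring].
have [->|->] : (x %% 2)%Z = 0 \/ (x %% 2)%Z = 1 by lia.
  by move=> _ ->; rewrite addr0 -mulrA mulrCA; lia.
by move=> -> ->; rewrite (_ : _ * _ = 2 * (2 * k * l + k + l) + 1); [lia | ring].
Qed.

Ltac quad_perm := move=> x y a c; rewrite !mem_quads => /and5P[? ? ? ? /eqP ?] ?;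
  split=> //; apply/and5P; split=> //; apply/eqP; lia.

Lemma sumq_types (p : nat) (F : int -> int -> int -> int -> int) : odd p ->
  sumq p (fun _ _ _ _ => true) F =
  sumq p typeI (fun x y a c => F x y a c + F x y c a + (F a c x y + F c a x y)) +
  sumq p typeII (fun x y a c => F x y a c + F a c x y).
Proof.
move=> p_odd; rewrite !sumqD.
have -> : sumq p typeI (fun x y a c => F x y c a) = sumq p (fun x y a c => typeI x y c a) F.
  apply/esym/(@sumq_reindex _ _ _ _ (fun x y a c => (x, y, c, a)) (fun x y a c => (x, y, c, a))); quad_perm.
have -> : sumq p typeI (fun x y a c => F a c x y) = sumq p (fun x y a c => typeI a c x y) F.
  apply/esym/(@sumq_reindex _ _ _ _ (fun x y a c => (a, c, x, y)) (fun x y a c => (a, c, x, y))); quad_perm.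
have -> : sumq p typeI (fun x y a c => F c a x y) = sumq p (fun x y a c => typeI a c y x) F.
  apply/esym/(@sumq_reindex _ _ _ _ (fun x y a c => (c, a, x, y)) (fun x y a c => (a, c, y, x))); quad_perm.
have -> : sumq p typeII (fun x y a c => F a c x y) = sumq p (fun x y a c => typeII a c x y) F.
  apply/esym/(@sumq_reindex _ _ _ _ (fun x y a c => (a, c, x, y)) (fun x y a c => (a, c, x, y))); quad_perm.
rewrite (@eq_sumq _ p _ F (fun x y a c => (if typeI x y a c then F x y a c else 0) +
  (if typeI x y c a then F x y a c else 0) +
  ((if typeI a c x y then F x y a c else 0) + (if typeI a c y x then F x y a c else 0)) +
  ((if typeII x y a c then F x y a c else 0) + (if typeII a c x y then F x y a c else 0)))).
  by rewrite !sumqD !sumq_if.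
move=> x y a c; rewrite mem_quads => /and5P[_ _ _ _ /eqP eq_p] _.
have : oddz (x * y + a * c) by rewrite eq_p /oddz; lia.
rewrite oddzD !oddzM /typeI /typeII.
by case: (oddz x); case: (oddz y); case: (oddz a); case: (oddz c) => //= _; rewrite ?add0r ?addr0.
Qed.

Definition cmpw (t : int) : int := if 0 < t then 2 else if t == 0 then 1 else 0.
Definition innerz (u v s t : int) : int :=
  cmpw (2 * s + v - u) * cmpw (2 * s + u - v) * (cmpw (2 * t + v - u) * cmpw (2 * t + u - v)).
Definition triz (t u v : int) : int := cmpw (t - (u - v)) * cmpw (t - (v - u)) * cmpw (u + v - t).

Lemma innerzC u v s t : innerz u v s t = innerz v u s t.
Proof. by rewrite /innerz; congr (_ * _); rewrite mulrC. Qed.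

Lemma innerz_swap u v s t : innerz u v s t = innerz u v t s.
Proof. by rewrite /innerz mulrC. Qed.

Lemma trizC t u v : triz t u v = triz t v u.
Proof. by rewrite /triz [u + v]addrC; congr (_ * _); rewrite mulrC. Qed.

Lemma int_of_sgnv z : int_of_Z (sgnv z) = cmpw (int_of_Z z).
Proof. by case: z => [|q|q] //=; rewrite /cmpw; rewrite ?ifT ?ifF; lia. Qed.

Lemma int_of_Z_mul y z : int_of_Z (Z.mul y z) = int_of_Z y * int_of_Z z.
Proof. by lia. Qed.

Lemma eval_innerw x y a c u v s t (u' v' s' t' : int) :
  lval (pt x y a c) u = Z_of_int u' -> lval (pt x y a c) v = Z_of_int v' ->
  lval (pt x y a c) s = Z_of_int s' -> lval (pt x y a c) t = Z_of_int t' ->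
  int_of_Z (eval (pt x y a c) (innerw u v s t)) = innerz u' v' s' t'.
Proof.
move=> eu ev es et; have lvD q l l' : lval q (lcomb 1 l l') = Z.add (lval q l) (lval q l').
  by rewrite /lval /=; ring.
have lvB q l l' : lval q (lcomb (-1) l l') = Z.sub (lval q l) (lval q l').
  by rewrite /lval /=; ring.
rewrite /= !int_of_Z_mul !int_of_sgnv !(lvD, lvB) eu ev es et.
by rewrite /innerz; congr (cmpw _ * cmpw _ * (cmpw _ * cmpw _)); lia.
Qed.

Lemma eval_triw x y a c t u v (t' u' v' : int) :
  lval (pt x y a c) t = Z_of_int t' -> lval (pt x y a c) u = Z_of_int u' ->
  lval (pt x y a c) v = Z_of_int v' ->
  int_of_Z (eval (pt x y a c) (triw t u v)) = triz t' u' v'.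
Proof.
move=> et eu ev; have lvD q l l' : lval q (lcomb 1 l l') = Z.add (lval q l) (lval q l').
  by rewrite /lval /=; ring.
have lvB q l l' : lval q (lcomb (-1) l l') = Z.sub (lval q l) (lval q l').
  by rewrite /lval /=; ring.
rewrite /= !int_of_Z_mul !int_of_sgnv !(lvD, lvB) eu ev et.
by rewrite /triz; congr (cmpw _ * cmpw _ * cmpw _); lia.
Qed.

Lemma lval_coord x y a c :
  [/\ lval (pt x y a c) vx = Z_of_int x, lval (pt x y a c) vy = Z_of_int y,
      lval (pt x y a c) va = Z_of_int a & lval (pt x y a c) vc = Z_of_int c].
Proof. by split; rewrite /lval /pt /=; ring. Qed.

Lemma int_of_Z_add y z : int_of_Z (Z.add y z) = int_of_Z y + int_of_Z z.
Proof. by lia. Qed.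

Lemma val_TBI x y a c : val TBI x y a c = innerz a c x y + 2 * triz c x y.
Proof.
have [ex ey ea ec] := lval_coord x y a c.
rewrite -(eval_innerw ea ec ex ey) -(eval_triw ec ex ey).
by rewrite -(_ : int_of_Z 2 = 2) // -int_of_Z_mul -int_of_Z_add.
Qed.

Lemma val_TBII x y a c : val TBII x y a c = 2 * triz x a c.
Proof.
have [ex ey ea ec] := lval_coord x y a c.
by rewrite -(eval_triw ex ea ec) -(_ : int_of_Z 2 = 2) // -int_of_Z_mul.
Qed.

Lemma val_TEI x y a c : val TEI x y a c = 2 * innerz x y a c + 4 * triz a x y + 8 * triz x a c.
Proof.
have [ex ey ea ec] := lval_coord x y a c.
rewrite -(eval_innerw ex ey ea ec) -(eval_triw ea ex ey) -(eval_triw ex ea ec).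
rewrite -(_ : int_of_Z 2 = 2) // -(_ : int_of_Z 4 = 4) // -(_ : int_of_Z 8 = 8) //.
by rewrite -!int_of_Z_mul -!int_of_Z_add.
Qed.

Lemma val_TEII x y a c :
  val TEII x y a c = innerz x y a c + innerz a c x y + 4 * triz a x y.
Proof.
have [ex ey ea ec] := lval_coord x y a c.
rewrite -(eval_innerw ex ey ea ec) -(eval_innerw ea ec ex ey) -(eval_triw ea ex ey).
by rewrite -(_ : int_of_Z 4 = 4) // -!int_of_Z_mul -!int_of_Z_add.
Qed.

Definition eqm4 (s t : int) : bool := (s == t %[mod 4])%Z.

Lemma Z_of_int_mod4 (t : int) : Z_of_int (t %% 4)%Z = Z.modulo (Z_of_int t) 4.
Proof.
by apply: (Z.mod_unique _ _ (Z_of_int (t %/ 4)%Z)); [left; lia | have := divz_eq t 4; lia].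
Qed.

Lemma eqb_mod4 (s t : int) :
  Z.eqb (Z.modulo (Z_of_int s) 4) (Z.modulo (Z_of_int t) 4) = eqm4 s t.
Proof. by rewrite -!Z_of_int_mod4 /eqm4; case: Z.eqb_spec => [?|?]; case: eqP => [?|?] //; lia. Qed.

Lemma val_TCII x y a c :
  val TCII x y a c = (if eqm4 (a + c) (x * y - 1) then innerz a c x y else 0) +
    (if eqm4 a 2 then 4 * triz a x y else 0).
Proof.
have [ex ey ea ec] := lval_coord x y a c.
rewrite -(eval_innerw ea ec ex ey) -(eval_triw ea ex ey) -!eqb_mod4.
have -> : Z.modulo (Z_of_int (a + c)) 4 = Z.modulo (Z.add (la (rmod (pt x y a c))) (lc (rmod (pt x y a c)))) 4.
  by rewrite /= -Zplus_mod; congr Z.modulo; lia.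
have -> : Z.modulo (Z_of_int (x * y - 1)) 4 =
    Z.modulo (Z.sub (Z.mul (lx (rmod (pt x y a c))) (ly (rmod (pt x y a c)))) 1) 4.
  by rewrite /= -Zminus_mod_idemp_l -Zmult_mod Zminus_mod_idemp_l; congr Z.modulo; lia.
have -> : Z.modulo (Z_of_int a) 4 = la (rmod (pt x y a c)) by [].
have -> : Z.modulo (Z_of_int 2) 4 = 2%zz by [].
rewrite -(_ : int_of_Z 4 = 4) // -int_of_Z_mul /val /valz /TCII.
by case: Z.eqb; case: Z.eqb; exact: int_of_Z_add.
Qed.

(** * Totals over the solutions, by residue class of [r] *)

Definition special_b (p : nat) (r a b c : int) : bool :=
  [&& eqm4 r (p%:Z - 1), eqm4 a c & ~~ eqm4 b a].

(** [phi] read through the two factorisations of [r^2 + a b + b c + c a], namely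
    [(r + b) (r - b) + (a + b) (b + c)] and [(a + c) (b - r) + (a + r) (c + r)]. Halving the factors
    gives a solution of [x y + a c = p]; the arguments of [phi] invert this. *)
Definition phi1 (phi : int -> int -> int -> int -> bool) x y a c :=
  phi (x + y) (2 * a - x + y) (x - y) (2 * c - x + y).
Definition phi2 (phi : int -> int -> int -> int -> bool) x z a c :=
  phi (a + c - x) (a - c + x) (2 * z + a + c - x) (c - a + x).
(** Accounts for twice the weighted count away from the boundary: the first part comes out doubled
    when [x] and [y] are exchanged, and the second, which has a factor 2 of its own, is doubled to
    match. *)
Definition quad_total (p : nat) phi : int :=
  sumq p (fun _ _ _ _ => true) (fun x y a c =>
    (if phi1 phi x y a c then innerz x y a c else 0) +
    4 * (if phi2 phi x y a c then triz x a c else 0)).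

Lemma oddzN x : oddz (- x) = oddz x.
Proof. by rewrite /oddz; lia. Qed.

Lemma quad_total_odd (p : nat) : prime p -> odd p ->
  quad_total p (fun r _ _ _ => oddz r) = 32 * (p%:Z - 1).
Proof.
move=> p_pr p_odd; rewrite /quad_total sumq_types //.
have -> : 32 * (p%:Z - 1) = (16 * (p%:Z - 1)) *+ 2 by lia.
rewrite -sum_bdB // -(balanced_sum p_pr balancedB) mulrnDl !mulr2n -!sumqD.
congr (_ + _); apply: eq_sumq => x y a c _; rewrite /phi1 /phi2 ?val_TBI ?val_TBII.
  rewrite /typeI !oddzD !oddzN => /and4P[-> -> /negbTE-> ->] /=.
  by rewrite [innerz c a _ _]innerzC; ring.
by rewrite /typeII !oddzD !oddzN => /and4P[-> -> /negbTE-> /negbTE->] /=; ring.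
Qed.

Lemma quad_total_even (p : nat) : prime p -> odd p ->
  quad_total p (fun r _ _ _ => ~~ oddz r) = 16 * (4 * p%:Z - 7).
Proof.
move=> p_pr p_odd; rewrite /quad_total sumq_types //.
rewrite -sum_bdE // -(balanced_sum p_pr balancedE).
congr (_ + _); apply: eq_sumq => x y a c _; rewrite /phi1 /phi2 ?val_TEI ?val_TEII.
  rewrite /typeI !oddzD !oddzN => /and4P[-> -> /negbTE-> ->] /=.
  by rewrite [innerz x y c a]innerz_swap [triz x c a]trizC; ring.
by rewrite /typeII !oddzD !oddzN => /and4P[-> -> /negbTE-> /negbTE->] /=; ring.
Qed.

Lemma eqm4_odd s t : eqm4 s t -> oddz s = oddz t.
Proof. by rewrite /eqm4 /oddz; lia. Qed.

Lemma eqm4_double s t : eqm4 (2 * s) (2 * t) = (oddz s == oddz t).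
Proof. by rewrite /eqm4 /oddz; lia. Qed.

Lemma eqm4_sub s t : eqm4 s t = eqm4 (s - t) 0.
Proof. by rewrite /eqm4; lia. Qed.

Lemma eqm4_cong s t s' t' q : s - t = s' - t' + 4 * q -> eqm4 s t = eqm4 s' t'.
Proof. by rewrite /eqm4 => eq_st; lia. Qed.

Lemma phi1_special p x y a c : phi1 (special_b p) x y a c =
  [&& eqm4 (x + y) (p%:Z - 1), oddz a == oddz c & oddz x (+) oddz y (+) oddz a].
Proof.
rewrite /phi1 /special_b; congr (_ && (_ && _)).
  by rewrite -eqm4_double [LHS]eqm4_sub [RHS]eqm4_sub; congr eqm4; ring.
rewrite [eqm4 _ _]eqm4_sub (_ : _ - _ = 2 * (x - y - a) - 2 * 0); last by ring.
by rewrite -eqm4_sub eqm4_double !oddzD !oddzN; case: (_ (+) _).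
Qed.

Lemma phi2_special p x z a c : phi2 (special_b p) x z a c =
  [&& eqm4 (a + c - x) (p%:Z - 1), oddz a == oddz c & oddz x (+) oddz z (+) oddz c].
Proof.
rewrite /phi2 /special_b; congr (_ && (_ && _)).
  by rewrite -eqm4_double [LHS]eqm4_sub [RHS]eqm4_sub; congr eqm4; ring.
rewrite [eqm4 _ _]eqm4_sub (_ : _ - _ = 2 * (x * (-1) + z + c) - 2 * 0); last by ring.
by rewrite -eqm4_sub eqm4_double mulrN1 !oddzD !oddzN; case: (_ (+) _).
Qed.

Lemma quad_total_special (p : nat) : prime p -> odd p ->
  quad_total p (special_b p) = if (p %% 4 == 1)%N then 8 * (p%:Z - 1) else 8 * (p%:Z - 3).
Proof.
move=> p_pr p_odd; rewrite /quad_total sumq_types //.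
rewrite -sum_bdC // -(balanced_sum p_pr balancedC).
have p1_even : oddz (p%:Z - 1) = false by rewrite /oddz; lia.
have off s : oddz s -> eqm4 s (p%:Z - 1) = false.
  by move=> so; apply/negP => /eqm4_odd; rewrite so p1_even.
congr (_ + _); apply: eq_sumq => x y a c; rewrite mem_quads => /and5P[_ _ _ _ /eqP eq_p].
  rewrite !phi1_special !phi2_special => /and4P[xo yo ae co].
  rewrite (off (a + c)) ?(off (c + a)) ?(off (x + y - c)) ?oddzD ?oddzN ?xo ?yo ?co ?(negbTE ae) //=.
  by rewrite !andbF !mulr0 !addr0.
rewrite val_TCII !phi1_special !phi2_special => /and4P[xo yo ae ce].
rewrite (off (a + c - x)) ?oddzD ?oddzN ?xo ?yo ?(negbTE ce) ?(negbTE ae) //= !andbF !andbT mulr0 !add0r.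
move: xo yo ae ce; rewrite /oddz => xo yo ae ce.
have [k xk] : exists k, x = 2 * k + 1 by exists (x %/ 2)%Z; lia.
have [l yl] : exists l, y = 2 * l + 1 by exists (y %/ 2)%Z; lia.
have [i ai] : exists i, a = 2 * i by exists (a %/ 2)%Z; lia.
have [j cj] : exists j, c = 2 * j by exists (c %/ 2)%Z; lia.
congr (_ + _).
  by rewrite (@eqm4_cong _ _ (a + c) (x * y - 1) (- (i * j))) // -eq_p ai cj; ring.
(* The difference [x + y - a - (p - 1)] equals [2 - a - (x - 1) (y - 1) - a c], and both products
   are divisible by 4. *)
have -> : eqm4 (x + y - a) (p%:Z - 1) = eqm4 a 2.
  rewrite [RHS]eqm4_sub [LHS]eqm4_sub.
  have -> : eqm4 (a - 2) 0 = eqm4 (2 - a) 0 by rewrite /eqm4; lia.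
  by rewrite -!eqm4_sub (@eqm4_cong _ _ 2 a (- (k * l + i * j))) // -eq_p xk yl ai cj; ring.
by case: ifP; rewrite ?mulr0.
Qed.

(** * From triples to solutions of [x * y + a * c = p] *)

Definition quad := (int * int * int * int)%type.

Definition ells (p : nat) : seq quad :=
  [seq (r, t.1.1, t.1.2, t.2) | r <- [seq r <- zrange (2 * p) | r ^+ 2 < (4 * p)%:Z],
                                t <- triples `|(4 * p)%:Z - r ^+ 2|].

Lemma mem_ells p r a b c : ((r, a, b, c) \in ells p) =
  [&& [&& 0 <= r, 0 <= a, 0 <= b & 0 <= c], same_parity a b, same_parity b c,
      r ^+ 2 < (4 * p)%:Z & r ^+ 2 + (a * b + b * c + c * a) == (4 * p)%:Z].
Proof.
apply/allpairsPdep/and5P => [[r' [[[a' b'] c'] []]]|[/and4P[r0 a0 b0 c0] ab bc r4 /eqP eq_p]].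
  rewrite mem_filter => /andP[r4 r'0]; rewrite mem_triples; last lia.
  move=> /and4P[/and3P[a0 b0 c0] ab bc /eqP eqN] /= [-> -> -> ->].
  by split=> //; [move: r'0; rewrite mem_zrange; lia | lia].
exists r, (a, b, c); split=> //.
  rewrite mem_filter r4 mem_zrange r0 /=.
  by rewrite leNgt; apply/negP => r2; move: r4; rewrite expr2; nia.
rewrite mem_triples; last lia.
by rewrite ab bc a0 b0 c0 /=; apply/eqP; lia.
Qed.

Lemma uniq_ells p : uniq (ells p).
Proof.
apply: allpairs_uniq_dep; first by rewrite filter_uniq ?uniq_zrange.
  by move=> r _; exact: uniq_triples.
by move=> [r [[a b] c]] [r' [[a' b'] c']] _ _ /= [-> -> -> ->].
Qed.

Definition ewt (e : quad) : int := let: (r, a, b, c) := e in hz r * twt a b c.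
Definition sume (p : nat) (phi : int -> int -> int -> int -> bool) : int :=
  \sum_(e <- ells p | let: (r, a, b, c) := e in phi r a b c) ewt e.

Lemma ell_parity p r a b c : (r, a, b, c) \in ells p -> same_parity r a.
Proof.
rewrite mem_ells => /and5P[_ ab bc _ /eqP]; rewrite expr2 => eq_p.
have : oddz (r * r + (a * b + b * c + c * a)) = false by rewrite eq_p /oddz; lia.
rewrite !oddzD !oddzM; move: ab bc; rewrite /same_parity /oddz.
by case: eqP; case: eqP; case: eqP; case: eqP => //=; lia.
Qed.

Lemma ell_pos p r a b c : (r, a, b, c) \in ells p -> [/\ 0 < a + b, 0 < b + c & 0 < c + a].
Proof.
rewrite mem_ells => /and5P[/and4P[r0 a0 b0 c0] _ _ r4 /eqP eq_p].
have H : 0 < a * b + b * c + c * a by rewrite -(ltrD2l (r ^+ 2)) addr0 eq_p.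
by split; rewrite lt_def addr_ge0 // andbT; apply/negP; rewrite paddr_eq0 // => /andP[/eqP z1 /eqP z2];
  move: H; rewrite z1 z2 ?(mul0r, mulr0, addr0, add0r) ltxx.
Qed.

Lemma cmpw_hz t : cmpw t = if 0 <= t then hz t else 0.
Proof. by rewrite /cmpw /hz; case: ltgtP. Qed.

Lemma sumq_swap (p : nat) (P : int -> int -> int -> int -> bool) F :
  sumq p P F = sumq p (fun x y a c => P y x a c) (fun x y a c => F y x a c) :> int.
Proof.
by apply: (@sumq_reindex _ _ _ _ (fun x y a c => (y, x, a, c)) (fun x y a c => (y, x, a, c)));
  quad_perm.
Qed.

(** Nonnegative triples give only [r^2 <= 4 p]; this makes the inequality strict, as membership in
    [ells] demands. *)
Lemma square_lt_4p (p : nat) (r : int) : prime p -> r ^+ 2 != (4 * p)%:Z.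
Proof.
move=> p_pr; apply/eqP; rewrite expr2 => eq_r.
have : oddz (r * r) = false by rewrite eq_r /oddz; lia.
rewrite oddzM andbb /oddz => r_even.
apply: (@prime_not_square p (r %/ 2)%Z p_pr); have [k rk] : exists k, r = 2 * k by exists (r %/ 2)%Z; lia.
have -> : (r %/ 2)%Z = k by lia.
by move: eq_r; rewrite rk; lia.
Qed.

(** The condition [b >= 0] becomes [y <= x]. A solution with [y < x] has [hz b = 2] and is shared
    with its mirror image [x < y], whereas [y = x] has [hz b = 1] and is its own mirror image, so
    the full sum is exactly twice the half. The folding requires [phi] to agree at mirror images. *)
Lemma link_inner (p : nat) (phi : int -> int -> int -> int -> bool) : prime p ->
  (forall x y a c, (x, y, a, c) \in quads p -> phi1 phi x y a c = phi1 phi y x a c) ->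
  2 * (\sum_(e <- ells p | let: (r, a, b, c) := e in phi r a b c && (b < r)) ewt e) =
  sumq p (phi1 phi) innerz.
Proof.
move=> p_pr phi_sym.
pose P x y a c := [&& phi1 phi x y a c, y <= x, 0 <= 2 * a - x + y & 0 <= 2 * c - x + y].
pose h (q : quad) : quad := let: (x, y, a, c) := q in (x + y, 2 * a - x + y, x - y, 2 * c - x + y).
pose g (e : quad) : quad := let: (r, a, b, c) := e in
  (((r + b) %/ 2)%Z, ((r - b) %/ 2)%Z, ((a + b) %/ 2)%Z, ((b + c) %/ 2)%Z).
rewrite (@big_reindex_cond _ _ _ (quads p) (ells p)
   (fun q => let: (x, y, a, c) := q in P x y a c) _ h g) ?uniq_quads ?uniq_ells //; last first.
- move=> [[[r a] b] c] e_in /andP[phi_e lt_br]; have := ell_parity e_in; have [ab0 bc0 _] := ell_pos e_in.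
  move: e_in; rewrite mem_ells => /and5P[/and4P[r0 a0 b0 c0] ab bc r4 /eqP eq_p] ra.
  move: ab bc ra; rewrite /same_parity => ab bc ra.
  have [x rx] : exists x, r = 2 * x - b by exists ((r + b) %/ 2)%Z; lia.
  have [u au] : exists u, a = 2 * u - b by exists ((a + b) %/ 2)%Z; lia.
  have [v cv] : exists v, c = 2 * v - b by exists ((b + c) %/ 2)%Z; lia.
  have eg : g (r, a, b, c) = (x, x - b, u, v) by rewrite /g; congr (_, _, _, _); lia.
  have eh : h (x, x - b, u, v) = (r, a, b, c) by rewrite /h; congr (_, _, _, _); lia.
  rewrite eg eh mem_quads; split=> //.
    apply/and5P; split; [lia|lia|lia|lia|apply/eqP].
    move: eq_p; rewrite rx au cv => eq_p.
    have : 4 * (x * (x - b) + u * v) = 4 * p%:Z by rewrite -[RHS]eq_p; ring.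
    by lia.
  by apply/and4P; split; [move: phi_e; rewrite /phi1; move: eh => /= -[-> -> -> ->] | lia | lia | lia].
- move=> [[[x y] a] c]; rewrite mem_quads => /and5P[x0 y0 a0 c0 /eqP eq_p] /and4P[phi_q le_yx a1 c1].
  rewrite mem_ells /same_parity; split; [|by rewrite /= -/(phi1 phi x y a c) phi_q; lia|rewrite /g /=; congr (_, _, _, _); lia].
  apply/and5P; split; [lia|lia|lia| |apply/eqP].
    2: by have -> : (4 * p)%:Z = 4 * (x * y + a * c); [lia | ring].
  have : 4 * (x * y + a * c) - (x + y) ^+ 2 =
     (2 * a - x + y) * (x - y) + (x - y) * (2 * c - x + y) + (2 * c - x + y) * (2 * a - x + y) by ring.
  rewrite eq_p => eq_4p; rewrite lt_neqAle square_lt_4p //=.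
  have xy0 : 0 <= x - y by lia.
  have := mulr_ge0 a1 xy0; have := mulr_ge0 xy0 c1; have := mulr_ge0 c1 a1; lia.
rewrite mulr_sumr.
have -> : \sum_(q <- quads p | let: (x, y, a, c) := q in P x y a c) 2 * ewt (h q) =
  sumq p (fun x y a c => phi1 phi x y a c && (y <= x)) innerz +
  sumq p (fun x y a c => phi1 phi x y a c && (y < x)) innerz.
  rewrite /sumq !(big_mkcond (fun q : quad => let: (x, y, a, c) := q in _ && _)) -big_split.
  rewrite big_mkcond [LHS]big_seq [RHS]big_seq; apply: eq_bigr => -[[[x y] a] c].
  rewrite mem_quads /P /= => /and5P[x0 y0 a0 c0 _]; case: (phi1 phi x y a c) => //=.
  have hz2 t : 0 < t -> hz t = 2 by rewrite /hz => t0; rewrite ifF //; lia.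
  have [le_yx|lt_xy] /= := leP y x; last by rewrite ltNge ltW.
  rewrite /innerz !cmpw_hz /twt.
  rewrite [2 * a + y - x]addrAC [2 * c + y - x]addrAC.
  have -> : (0 <= 2 * a + x - y) by lia.
  have -> : (0 <= 2 * c + x - y) by lia.
  rewrite (hz2 (2 * a + x - y)) ?(hz2 (2 * c + x - y)) ?(hz2 (x + y)); [|lia|lia|lia].
  case: (0 <= 2 * a - x + y) => //=; last by rewrite !mul0r if_same.
  case: (0 <= 2 * c - x + y) => //=; last by rewrite !mul0r !mulr0 if_same.
  have [lt_yx|] := ltP y x; first by rewrite (hz2 (x - y)); [ring | lia].
  by move=> le_xy; rewrite /(hz (x - y)) ifT; [ring | lia].
rewrite [X in _ + X]sumq_swap.
rewrite [X in _ = X](@eq_sumq _ _ _ _ (fun x y a c => (if y <= x then innerz x y a c else 0) + (if x < y then innerz x y a c else 0))); last first.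
  by move=> x y a c _ _; case: leP; rewrite ?addr0 ?add0r.
rewrite [RHS]sumqD !sumq_if; congr (_ + _).
rewrite /sumq [LHS]big_seq_cond [RHS]big_seq_cond; apply: eq_big => -[[[x y] a] c] /=.
  by case qs: (_ \in _) => //=; rewrite (phi_sym x y a c).
by move=> _; rewrite innerzC.
Qed.

(** The conditions that [r], [a] and [c] are nonnegative become the weak triangle inequalities for
    [x], [a], [c], and [z] does not enter the weight. The factor 2 is [hz b], as [b > r >= 0]. *)
Lemma link_tri (p : nat) (phi : int -> int -> int -> int -> bool) : prime p ->
  \sum_(e <- ells p | let: (r, a, b, c) := e in
     [&& phi r a b c, r < b, 0 < a + r & 0 < c + r]) ewt e =
  2 * sumq p (phi2 phi) (fun x _ a c => triz x a c).
Proof.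
move=> p_pr.
pose P x z a c := [&& phi2 phi x z a c, 0 <= a + c - x, 0 <= a - c + x & 0 <= c - a + x].
pose h (q : quad) : quad := let: (x, z, a, c) := q in
  (a + c - x, a - c + x, 2 * z + a + c - x, c - a + x).
pose g (e : quad) : quad := let: (r, a, b, c) := e in
  (((a + c) %/ 2)%Z, ((b - r) %/ 2)%Z, ((a + r) %/ 2)%Z, ((c + r) %/ 2)%Z).
rewrite (@big_reindex_cond _ _ _ (quads p) (ells p)
   (fun q => let: (x, z, a, c) := q in P x z a c) _ h g) ?uniq_quads ?uniq_ells //; last first.
- move=> [[[r a] b] c] e_in /and4P[phi_e lt_rb ar0 cr0]; have := ell_parity e_in; have [_ _ ca0] := ell_pos e_in.
  move: e_in; rewrite mem_ells => /and5P[/and4P[r0 a0 b0 c0] ab bc r4 /eqP eq_p] ra.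
  move: ab bc ra; rewrite /same_parity => ab bc ra.
  have [u au] : exists u, a = 2 * u - r by exists ((a + r) %/ 2)%Z; lia.
  have [v cv] : exists v, c = 2 * v - r by exists ((c + r) %/ 2)%Z; lia.
  have [z bz] : exists z, b = 2 * z + r by exists ((b - r) %/ 2)%Z; lia.
  have eg : g (r, a, b, c) = (u + v - r, z, u, v) by rewrite /g; congr (_, _, _, _); lia.
  have eh : h (u + v - r, z, u, v) = (r, a, b, c) by rewrite /h; congr (_, _, _, _); lia.
  rewrite eg eh mem_quads; split=> //.
    apply/and5P; split; [lia|lia|lia|lia|apply/eqP].
    move: eq_p; rewrite bz au cv => eq_p.
    have : 4 * ((u + v - r) * z + u * v) = 4 * p%:Z.
      by have <- : (4 * p)%:Z = 4 * p%:Z; [lia | rewrite -[RHS]eq_p; ring].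
    by lia.
  by apply/and4P; split; [move: phi_e; rewrite /phi2; move: eh => /= -[-> -> -> ->] | lia | lia | lia].
- move=> [[[x z] a] c]; rewrite mem_quads => /and5P[x0 z0 a0 c0 /eqP eq_p] /and4P[phi_q r1 a1 c1].
  rewrite mem_ells /same_parity; split; [|by rewrite /= -/(phi2 phi x z a c) phi_q; lia|rewrite /g /=; congr (_, _, _, _); lia].
  apply/and5P; split; [lia|lia|lia| |apply/eqP].
    2: by have -> : (4 * p)%:Z = 4 * (x * z + a * c); [lia | ring].
  have : 4 * (x * z + a * c) - (a + c - x) ^+ 2 =
    (a - c + x) * (2 * z + a + c - x) + (2 * z + a + c - x) * (c - a + x) + (c - a + x) * (a - c + x) by ring.
  rewrite eq_p => eq_4p; rewrite lt_neqAle square_lt_4p //=.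
  have b1 : 0 <= 2 * z + a + c - x by lia.
  have := mulr_ge0 a1 b1; have := mulr_ge0 b1 c1; have := mulr_ge0 c1 a1; lia.
rewrite /sumq mulr_sumr !(big_mkcond (fun q : quad => let: (x, y, a, c) := q in _)).
rewrite [LHS]big_seq [RHS]big_seq; apply: eq_bigr => -[[[x z] a] c].
rewrite mem_quads /P /= => /and5P[x0 z0 a0 c0 _]; case: (phi2 phi x z a c) => //=.
rewrite /triz !cmpw_hz /twt !opprB !addrA.
have -> : x + c - a = c - a + x by ring.
have -> : x + a - c = a - c + x by ring.
case r0: (0 <= a + c - x); case a1: (0 <= a - c + x); case c1: (0 <= c - a + x) => /=; rewrite ?mulr0 ?mul0r ?mulr0 //.
by rewrite [hz (2 * z + a + c - x)](_ : _ = 2) /hz; [ring | rewrite ifF //; lia].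
Qed.

(* The solutions with [r = b], or with [r < b] and [a = r = 0] or [c = r = 0]. *)
Definition boundary (p : nat) : seq quad :=
  [:: (0, 0, 2, 2 * p%:Z); (0, 0, 2 * p%:Z, 2); (0, 2, 2 * p%:Z, 0); (0, 2 * p%:Z, 2, 0);
      (0, 2, 0, 2 * p%:Z); (1, 1, 1, 2 * p%:Z - 1); (2, 0, 2, 2 * p%:Z - 2);
      (0, 2 * p%:Z, 0, 2); (1, 2 * p%:Z - 1, 1, 1); (2, 2 * p%:Z - 2, 2, 0)].

Lemma uniq_boundary p : (2 < p)%N -> uniq (boundary p).
Proof. by move=> p2; rewrite /= !inE !xpair_eqE; lia. Qed.

Lemma boundary_ell p : (2 < p)%N -> {in boundary p, forall e, e \in ells p /\
  let: (r, a, b, c) := e in (r == b) || ((r < b) && ((a + r == 0) || (c + r == 0)))}.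
Proof.
move=> p2 [[[r a] b] c]; rewrite mem_ells /same_parity !inE expr2 !xpair_eqE.
by repeat (case/orP; [move=> /andP[/andP[/andP[/eqP-> /eqP->] /eqP->] /eqP->]; split; [apply/and5P; split; lia | lia]|]);
  move=> /andP[/andP[/andP[/eqP-> /eqP->] /eqP->] /eqP->]; split; [apply/and5P; split; lia | lia].
Qed.

(** If [r = b], the equation is [(a + b) (b + c) = 4 p]. Otherwise [r = 0] and one of [a], [c]
    vanishes, so the other one times [b] is [4 p]. In both cases the factors are even, hence they
    are 2 and [2 p]. *)
Lemma ell_boundary (p : nat) r a b c : prime p -> (r, a, b, c) \in ells p -> r <= b ->
  ~~ [&& r < b, 0 < a + r & 0 < c + r] -> (r, a, b, c) \in boundary p.
Proof.
move=> p_pr e_in le_rb; have := ell_parity e_in; have [ab0 bc0 ca0] := ell_pos e_in.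
move: e_in; rewrite mem_ells expr2 => /and5P[/and4P[r0 a0 b0 c0] ab bc r4 /eqP eq_p] ra.
move: ab bc ra; rewrite /same_parity => ab bc ra.
have factor s t : 0 < s -> 0 < t -> (s %% 2)%Z = 0 -> (t %% 2)%Z = 0 -> s * t = 4 * p%:Z ->
    (s = 2 /\ t = 2 * p%:Z) \/ (t = 2 /\ s = 2 * p%:Z).
  move=> s0 t0 s2 t2 st.
  have [u su] : exists u, s = 2 * u by exists (s %/ 2)%Z; lia.
  have [v tv] : exists v, t = 2 * v by exists (t %/ 2)%Z; lia.
  have uv : u * v = p%:Z by move: st; rewrite su tv; lia.
  by have [||u1|v1] := @prime_factorz p u v p_pr _ _ uv;
    [lia|lia|left; move: uv; rewrite u1; lia|right; move: uv; rewrite v1; lia].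
rewrite negb_and -leNgt => out.
have [eq_rb|lt_rb] : r = b \/ r < b by lia.
  have [[es et]|[et es]] : (a + b = 2 /\ b + c = 2 * p%:Z) \/ (b + c = 2 /\ a + b = 2 * p%:Z).
  - apply: factor => //; [lia|lia|].
    by have -> : 4 * p%:Z = (4 * p)%:Z; [lia | rewrite -eq_p eq_rb; ring].
  - have ea : a = 2 - b by lia.
    have ec : c = 2 * p%:Z - b by lia.
    have [eb|[eb|eb]] : b = 0 \/ b = 1 \/ b = 2 by lia.
    + have -> : (r, a, b, c) = (0, 2, 0, 2 * p%:Z) by congr (_, _, _, _); lia.
      by rewrite !inE eqxx ?orbT.
    + have -> : (r, a, b, c) = (1, 1, 1, 2 * p%:Z - 1) by congr (_, _, _, _); lia.
      by rewrite !inE eqxx ?orbT.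
    + have -> : (r, a, b, c) = (2, 0, 2, 2 * p%:Z - 2) by congr (_, _, _, _); lia.
      by rewrite !inE eqxx ?orbT.
  - have ec : c = 2 - b by lia.
    have ea : a = 2 * p%:Z - b by lia.
    have [eb|[eb|eb]] : b = 0 \/ b = 1 \/ b = 2 by lia.
    + have -> : (r, a, b, c) = (0, 2 * p%:Z, 0, 2) by congr (_, _, _, _); lia.
      by rewrite !inE eqxx ?orbT.
    + have -> : (r, a, b, c) = (1, 2 * p%:Z - 1, 1, 1) by congr (_, _, _, _); lia.
      by rewrite !inE eqxx ?orbT.
    + have -> : (r, a, b, c) = (2, 2 * p%:Z - 2, 2, 0) by congr (_, _, _, _); lia.
      by rewrite !inE eqxx ?orbT.
have [[ea er]|[ec er]] : (a = 0 /\ r = 0) \/ (c = 0 /\ r = 0) by lia.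
- have [[eb ec]|[ec eb]] : (b = 2 /\ c = 2 * p%:Z) \/ (c = 2 /\ b = 2 * p%:Z).
    apply: factor; [lia|lia|lia|lia|].
    by have -> : 4 * p%:Z = (4 * p)%:Z; [lia | rewrite -eq_p ea er; ring].
  + have -> : (r, a, b, c) = (0, 0, 2, 2 * p%:Z) by congr (_, _, _, _); lia.
      by rewrite !inE eqxx ?orbT.
  + have -> : (r, a, b, c) = (0, 0, 2 * p%:Z, 2) by congr (_, _, _, _); lia.
      by rewrite !inE eqxx ?orbT.
- have [[ea eb]|[eb ea]] : (a = 2 /\ b = 2 * p%:Z) \/ (b = 2 /\ a = 2 * p%:Z).
    apply: factor; [lia|lia|lia|lia|].
    by have -> : 4 * p%:Z = (4 * p)%:Z; [lia | rewrite -eq_p ec er; ring].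
  + have -> : (r, a, b, c) = (0, 2, 2 * p%:Z, 0) by congr (_, _, _, _); lia.
      by rewrite !inE eqxx ?orbT.
  + have -> : (r, a, b, c) = (0, 2 * p%:Z, 2, 0) by congr (_, _, _, _); lia.
      by rewrite !inE eqxx ?orbT.
Qed.

Definition boundary_sum (p : nat) (phi : int -> int -> int -> int -> bool) : int :=
  \sum_(e <- boundary p | let: (r, a, b, c) := e in phi r a b c) ewt e.

Lemma sume_split (p : nat) (phi : int -> int -> int -> int -> bool) : prime p -> odd p ->
  (forall x y a c, (x, y, a, c) \in quads p -> phi1 phi x y a c = phi1 phi y x a c) ->
  2 * sume p phi = quad_total p phi + 2 * boundary_sum p phi.
Proof.
move=> p_pr p_odd phi_sym.
have p2 : (2 < p)%N by have := prime_gt1 p_pr; lia.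
have -> : sume p phi =
    (\sum_(e <- ells p | let: (r, a, b, c) := e in phi r a b c && (b < r)) ewt e) +
    (\sum_(e <- ells p | let: (r, a, b, c) := e in [&& phi r a b c, r < b, 0 < a + r & 0 < c + r]) ewt e) +
    boundary_sum p phi.
  have -> : boundary_sum p phi = \sum_(e <- ells p | let: (r, a, b, c) := e in
      [&& phi r a b c, r <= b & ~~ [&& r < b, 0 < a + r & 0 < c + r]]) ewt e.
    rewrite [RHS](@big_reindex_cond _ _ _ (boundary p) (ells p)
      (fun e => let: (r, a, b, c) := e in phi r a b c) _ id id) ?uniq_boundary ?uniq_ells //.
      move=> [[[r a] b] c] /(boundary_ell p2)[e_in out] phi_e; split=> //.
      move: e_in; rewrite phi_e mem_ells => /and5P[/and4P[r0 a0 b0 c0] _ _ _ _]; lia.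
    by move=> [[[r a] b] c] e_in /and3P[phi_e le_rb out]; split=> //; apply: ell_boundary.
  rewrite /sume [in LHS]big_mkcond ![in RHS](big_mkcond (fun e : quad => let: (r, a, b, c) := e in _)) -!big_split.
  apply: eq_bigr => -[[[r a] b] c] _; case: (phi r a b c) => //=.
  by case: (ltgtP r b) => _ /=; case: (0 < a + r); case: (0 < c + r); rewrite /= ?addr0 ?add0r.
rewrite !mulrDr link_inner // link_tri // /quad_total sumqD sumq_if.
congr (_ + _ + _); rewrite mulrA.
rewrite -[sumq p (phi2 phi) _](sumq_if p (fun _ _ _ _ => true) (phi2 phi)) /sumq mulr_sumr.
by apply: eq_bigr => -[[[x y] a] c].
Qed.

(** * Weighted counts over residue classes *)

Lemma boundary_sumE p phi : (2 < p)%N -> boundary_sum p phi =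
  (if phi 0 0 2 (2 * p%:Z) then 4 else 0) + (if phi 0 0 (2 * p%:Z) 2 then 4 else 0) +
  (if phi 0 2 (2 * p%:Z) 0 then 4 else 0) + (if phi 0 (2 * p%:Z) 2 0 then 4 else 0) +
  ((if phi 0 2 0 (2 * p%:Z) then 4 else 0) + (if phi 0 (2 * p%:Z) 0 2 then 4 else 0) +
   ((if phi 1 1 1 (2 * p%:Z - 1) then 16 else 0) + (if phi 1 (2 * p%:Z - 1) 1 1 then 16 else 0)) +
   ((if phi 2 0 2 (2 * p%:Z - 2) then 8 else 0) + (if phi 2 (2 * p%:Z - 2) 2 0 then 8 else 0))).
Proof.
move=> p2; rewrite /boundary_sum big_mkcond /boundary.
have h1 : hz (2 * p%:Z) = 2 by rewrite /hz ifF //; lia.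
have h2 : hz (2 * p%:Z - 1) = 2 by rewrite /hz ifF //; lia.
have h3 : hz (2 * p%:Z - 2) = 2 by rewrite /hz ifF //; lia.
have [w1 w2 w3 w4] : [/\ ewt (0, 0, 2, 2 * p%:Z) = 4, ewt (0, 0, 2 * p%:Z, 2) = 4, ewt (0, 2, 2 * p%:Z, 0) = 4 & ewt (0, 2 * p%:Z, 2, 0) = 4].
  by rewrite /ewt /twt h1.
have [w5 w6 w7] : [/\ ewt (0, 2, 0, 2 * p%:Z) = 4, ewt (1, 1, 1, 2 * p%:Z - 1) = 16 & ewt (2, 0, 2, 2 * p%:Z - 2) = 8].
  by rewrite /ewt /twt h1 h2 h3.
have [w8 w9 w0] : [/\ ewt (0, 2 * p%:Z, 0, 2) = 4, ewt (1, 2 * p%:Z - 1, 1, 1) = 16 & ewt (2, 2 * p%:Z - 2, 2, 0) = 8].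
  by rewrite /ewt /twt h1 h2 h3.
rewrite !big_cons big_nil w1 w2 w3 w4 w5 w6 w7 w8 w9 w0.
rewrite /=; ring.
Qed.

Lemma sume_odd (p : nat) : prime p -> odd p -> sume p (fun r _ _ _ => oddz r) = 16 * (p%:Z + 1).
Proof.
move=> p_pr p_odd; have p2 : (2 < p)%N by have := prime_gt1 p_pr; lia.
have := @sume_split p (fun r _ _ _ => oddz r) p_pr p_odd.
rewrite quad_total_odd // boundary_sumE //= => H.
have {}H := H (fun x y _ _ _ => congr1 oddz (addrC x y)).
lia.
Qed.

Lemma sume_even (p : nat) : prime p -> odd p -> sume p (fun r _ _ _ => ~~ oddz r) = 16 * (2 * p%:Z - 1).
Proof.
move=> p_pr p_odd; have p2 : (2 < p)%N by have := prime_gt1 p_pr; lia.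
have := @sume_split p (fun r _ _ _ => ~~ oddz r) p_pr p_odd.
rewrite quad_total_even // boundary_sumE //= => H.
have {}H := H (fun x y _ _ _ => congr1 (fun t => ~~ oddz t) (addrC x y)).
lia.
Qed.

(** The boundary contributes 8 if [p] is 1 modulo 4 and 16 otherwise. Doubled, this evens out the
    two values of the total: [8 (p - 1) + 16 = 8 (p - 3) + 32]. *)
Lemma sume_special (p : nat) : prime p -> odd p -> sume p (special_b p) = 4 * (p%:Z + 1).
Proof.
move=> p_pr p_odd; have p2 : (2 < p)%N by have := prime_gt1 p_pr; lia.
have H : forall x y a c, (x, y, a, c) \in quads p ->
    phi1 (special_b p) x y a c = phi1 (special_b p) y x a c.
  by move=> x y a c _; rewrite !phi1_special (addrC x y) (addbC (oddz x)).
have {H} := sume_split p_pr p_odd H.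
rewrite quad_total_special // boundary_sumE // /special_b.
have -> : eqm4 0 (p%:Z - 1) = (p %% 4 == 1)%N by rewrite /eqm4; lia.
have -> : eqm4 1 (p%:Z - 1) = false by rewrite /eqm4; lia.
have -> : eqm4 2 (p%:Z - 1) = (p %% 4 != 1)%N by rewrite /eqm4; lia.
have -> : eqm4 0 (2 * p%:Z) = false by rewrite /eqm4; lia.
have -> : eqm4 (2 * p%:Z) 0 = false by rewrite /eqm4; lia.
have -> : eqm4 2 (2 * p%:Z) = true by rewrite /eqm4; lia.
have -> : eqm4 (2 * p%:Z) 2 = true by rewrite /eqm4; lia.
have -> : eqm4 0 (2 * p%:Z - 2) = true by rewrite /eqm4; lia.
have -> : eqm4 (2 * p%:Z - 2) 0 = true by rewrite /eqm4; lia.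
have -> : eqm4 2 (2 * p%:Z - 2) = false by rewrite /eqm4; lia.
have -> : eqm4 0 2 = false by [].
have -> : eqm4 2 0 = false by [].
rewrite -/(special_b p); case: (p %% 4 == 1)%N => /=; lia.
Qed.

Lemma sume_perm p phi :
  sume p phi = sume p (fun r a b c => phi r b a c) /\ sume p phi = sume p (fun r a b c => phi r a c b).
Proof.
split.
- rewrite {1}/sume (@big_reindex_cond _ _ _ (ells p) (ells p)
    (fun e : quad => let: (r, a, b, c) := e in phi r b a c) _
    (fun e : quad => let: (r, a, b, c) := e in (r, b, a, c))
    (fun e : quad => let: (r, a, b, c) := e in (r, b, a, c))) ?uniq_ells //.
  + by apply: eq_bigr => -[[[r a] b] c] _; rewrite /ewt /twt [hz b * _]mulrC.
  + by move=> [[[r a] b] c] e_in phi_e; split=> //; move: e_in; rewrite !mem_ells /same_parity; lia.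
  + by move=> [[[r a] b] c] e_in phi_e; split=> //; move: e_in; rewrite !mem_ells /same_parity; lia.
- rewrite {1}/sume (@big_reindex_cond _ _ _ (ells p) (ells p)
    (fun e : quad => let: (r, a, b, c) := e in phi r a c b) _
    (fun e : quad => let: (r, a, b, c) := e in (r, a, c, b))
    (fun e : quad => let: (r, a, b, c) := e in (r, a, c, b))) ?uniq_ells //.
  + by apply: eq_bigr => -[[[r a] b] c] _; rewrite /ewt /twt mulrAC.
  + by move=> [[[r a] b] c] e_in phi_e; split=> //; move: e_in; rewrite !mem_ells /same_parity; lia.
  + by move=> [[[r a] b] c] e_in phi_e; split=> //; move: e_in; rewrite !mem_ells /same_parity; lia.
Qed.

(** If [a], [b], [c] agreed modulo 4, then [r = 2 s] and [a = 2 u] would make [p] congruent to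
    [s^2 + 3 u^2]. For even [s] the class of [r] forces [p] to be 1 modulo 4, but the sum is 0 or 3;
    for odd [s] it forces 3, but the sum is 0 or 1. *)
Lemma ell_special p r a b c : odd p -> (r, a, b, c) \in ells p -> eqm4 r (p%:Z - 1) ->
  [/\ oddz a = false, oddz b = false, oddz c = false & ~~ (eqm4 a b && eqm4 b c)].
Proof.
move=> p_odd e_in; have := ell_parity e_in.
move: e_in; rewrite mem_ells /same_parity => /and5P[_ ab bc _ /eqP eq_p] ra r4.
have r2 : oddz r = false by rewrite (eqm4_odd r4) /oddz; lia.
move: r2 ab bc ra; rewrite /oddz => r2 ab bc ra.
split; [lia|lia|lia|]; apply/negP => /andP[]; rewrite /eqm4 => ab4 bc4.
have [s rs] : exists s, r = 2 * s by exists (r %/ 2)%Z; lia.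
have [u au] : exists u, a = 2 * u by exists (a %/ 2)%Z; lia.
have [i bi] : exists i, b = 2 * (u + 2 * i) by exists ((b - a) %/ 4)%Z; lia.
have [j cj] : exists j, c = 2 * (u + 2 * j) by exists ((c - a) %/ 4)%Z; lia.
have eq_p' : s * s + 3 * (u * u) + 4 * (u * i + u * j + i * j) = p%:Z.
  have : 4 * (s * s + 3 * (u * u) + 4 * (u * i + u * j + i * j)) = 4 * p%:Z; last by lia.
  by have <- : (4 * p)%:Z = 4 * p%:Z; [lia | rewrite -eq_p rs au bi cj; ring].
have [q rq] : exists q, 2 * s = p%:Z - 1 + 4 * q.
  by move: r4; rewrite rs /eqm4; clear=> r4; exists ((2 * s - p%:Z + 1) %/ 4)%Z; lia.
set w := u * i + u * j + i * j in eq_p'; clearbody w.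
move: eq_p' rq p_odd; clear.
have [s' [->|->]] : exists s', s = 2 * s' \/ s = 2 * s' + 1 by exists (s %/ 2)%Z; lia.
  have [u' [->|->]] : exists u', u = 2 * u' \/ u = 2 * u' + 1 by exists (u %/ 2)%Z; lia.
    by lia.
  by lia.
have [u' [->|->]] : exists u', u = 2 * u' \/ u = 2 * u' + 1 by exists (u %/ 2)%Z; lia.
  by lia.
by lia.
Qed.

Lemma sume_class (p : nat) : prime p -> odd p ->
  sume p (fun r _ _ _ => eqm4 r (p%:Z - 1)) = 12 * (p%:Z + 1).
Proof.
move=> p_pr p_odd; have S := sume_special p_pr p_odd.
have [eS1 eS2] := sume_perm p (special_b p).
have S1 := etrans (esym eS1) S; have S2 := etrans (esym eS2) S.
have -> : 12 * (p%:Z + 1) = 4 * (p%:Z + 1) + 4 * (p%:Z + 1) + 4 * (p%:Z + 1) by ring.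
rewrite -{1}S -{1}S1 -S2.
rewrite /sume !(big_mkcond (fun e : quad => let: (r, a, b, c) := e in _)) -!big_split.
rewrite [LHS]big_seq [RHS]big_seq; apply: eq_bigr => -[[[r a] b] c] e_in /=.
rewrite /special_b; case r4: (eqm4 r _); last by rewrite !addr0.
have [ao bo co out] := ell_special p_odd e_in r4; rewrite /=.
move: (hz r * _) ao bo co out; rewrite /eqm4 /oddz => w ao bo co out.
have [a4|a4] : (a %% 4)%Z = 0 \/ (a %% 4)%Z = 2 by lia.
all: have [b4|b4] : (b %% 4)%Z = 0 \/ (b %% 4)%Z = 2 by lia.
all: have [c4|c4] : (c %% 4)%Z = 0 \/ (c %% 4)%Z = 2 by lia.
all: by move: out; rewrite a4 b4 c4 //= ?addr0 ?add0r.
Qed.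

(** * Sums of class numbers over [r] of both signs *)

Lemma sym_range_opp (R : nmodType) n (P : pred int) (f : int -> R) :
  \sum_(r <- sym_range n | P r) f r = \sum_(r <- sym_range n | P (- r)) f (- r).
Proof.
apply: (@big_reindex_cond _ _ _ _ _ _ _ -%R -%R); rewrite ?uniq_sym_range //.
- by move=> r; rewrite !mem_sym_range opprK => r_in Pr; split=> //; lia.
- by move=> r; rewrite !mem_sym_range opprK => r_in Pr; split=> //; lia.
Qed.

Lemma sym_range_even n (P : pred int) (f : int -> int) :
  (forall r, P (- r) = P r) -> (forall r, f (- r) = f r) ->
  \sum_(r <- sym_range n | P r) f r = \sum_(r <- zrange n | P r) hz r * f r.
Proof.
move=> Peven feven; rewrite (bigID (fun r => 0 <= r)) /=.
rewrite [X in X + _](@big_reindex_cond _ _ _ (zrange n) _ P _ id id) ?uniq_sym_range ?uniq_zrange //.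
- rewrite [X in _ + X](@big_reindex_cond _ _ _ (zrange n) _ (fun r => P r && (0 < r)) _ -%R -%R)
    ?uniq_sym_range ?uniq_zrange //.
  + rewrite [X in X + _]big_mkcond [X in _ + X]big_mkcond -big_split [RHS]big_mkcond /=.
    rewrite [LHS]big_seq [RHS]big_seq; apply: eq_bigr => r; rewrite mem_zrange /hz feven => r0.
    by case: (P r) => //=; case: (eqVneq r 0) => [->|nr]; rewrite ?ltxx ?ifT; lia.
  + by move=> r; rewrite mem_sym_range mem_zrange Peven opprK => ? /andP[-> ?]; split=> //; lia.
  + by move=> r; rewrite mem_sym_range mem_zrange Peven opprK => ? /andP[-> ?]; split=> //; lia.
- by move=> r; rewrite mem_sym_range mem_zrange => ? ->; split=> //; lia.
- by move=> r; rewrite mem_sym_range mem_zrange => ? /andP[-> ?]; split=> //; lia.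
Qed.

Definition hsum (p : nat) (psi : pred int) : rat :=
  \sum_(r <- sym_range (2 * p) | (r ^+ 2 < (4 * p)%:Z) && psi r) hurwitz `|(4 * p)%:Z - r ^+ 2|%N.

(** The factor [hz r] in the weights accounts for [r] and [-r]. The strict bound on [r^2] keeps the
    argument of [hurwitz] positive, so the value at 0 never enters. *)
Lemma hsum_ell (p : nat) (psi : pred int) : (forall r, psi (- r) = psi r) ->
  24 * hsum p psi = (sume p (fun r _ _ _ => psi r))%:~R.
Proof.
move=> psi_even; rewrite /hsum mulr_sumr.
rewrite (eq_bigr (fun r => (sumt `|(4 * p)%:Z - r ^+ 2|%N twt)%:~R)); last first.
  by move=> r /andP[r4 _]; rewrite hurwitz_tri //; lia.
rewrite -[LHS](raddf_sum intr) /= sym_range_even; last 2 first.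
- by move=> r; rewrite sqrrN psi_even.
- by move=> r; rewrite sqrrN.
congr (_%:~R); rewrite /sume [RHS]big_mkcond /ells big_allpairs_dep big_filter /=.
rewrite [LHS]big_mkcondr; apply: eq_bigr => r _.
case: (psi r); last by rewrite big1.
by rewrite /sumt mulr_sumr; apply: eq_bigr => -[[a b] c].
Qed.

Lemma hsum_eqm p c c' : eqm4 c c' -> hsum p (eqm4^~ c) = hsum p (eqm4^~ c').
Proof. by move=> cc'; apply: eq_bigl => r; congr (_ && _); move: cc'; rewrite /eqm4; lia. Qed.

Lemma hsum_opp p c : hsum p (eqm4^~ c) = hsum p (eqm4^~ (- c)).
Proof.
rewrite /hsum sym_range_opp; apply: eq_big => [r|r _]; last by rewrite sqrrN.
by rewrite sqrrN; congr (_ && _); rewrite /eqm4; lia.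
Qed.

Lemma hsum_parity p c : hsum p (fun r => oddz r == oddz c) = hsum p (eqm4^~ c) + hsum p (eqm4^~ (c + 2)).
Proof.
rewrite /hsum (bigID (eqm4^~ c)) /=; congr (_ + _); apply: eq_bigl => r; rewrite -andbA;
  by congr (_ && _); rewrite /oddz /eqm4; lia.
Qed.

Theorem theorem2 (p : nat) (c : int) :
  prime p -> odd p ->
  let S := \sum_(r <- [seq (i%:Z - (2 * p)%:Z) | i <- iota 0 (4 * p).+1]
                 | (r ^+ 2 < (4 * p)%:Z) && (r == c %[mod 4])%Z)
             hurwitz `|(4 * p)%:Z - r ^+ 2|%N in
  (((c == 1 %[mod 4])%Z || (c == -1 %[mod 4])%Z) -> S = (p%:R + 1) / 3) /\
  ((c == (p + 1)%:Z %[mod 4])%Z -> S = (5 * p%:R - 7) / 6) /\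
  ((c == (p%:Z - 1) %[mod 4])%Z -> S = (p%:R + 1) / 2).
Proof.
move=> p_pr p_odd S; have {S}-> : S = hsum p (eqm4^~ c) by rewrite /S /hsum /sym_range mulnA.
have odd_sum : hsum p (eqm4^~ 1) = (p%:R + 1) / 3.
  have := hsum_ell p (fun r => congr1 (eq_op^~ (oddz 1)) (oddzN r)).
  (* The odd integers split into the classes of 1 and -1, which [r] to [-r] exchanges, so each
     carries half of the odd total. *)
  rewrite hsum_parity (@hsum_eqm _ (1 + 2) (- 1)) // -hsum_opp.
  have -> : sume p (fun r _ _ _ => oddz r == oddz 1) = 16 * (p%:Z + 1).
    by rewrite -sume_odd //; apply: eq_bigl => -[[[r a] b] c']; rewrite eqb_id.
  by rewrite rmorphM rmorphD /= -pmulrn; lra.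
have class_even r : eqm4 (- r) (p%:Z - 1) = eqm4 r (p%:Z - 1) by rewrite /eqm4; lia.
have class_sum : hsum p (eqm4^~ (p%:Z - 1)) = (p%:R + 1) / 2.
  have := hsum_ell p class_even; rewrite sume_class // rmorphM rmorphD /= -pmulrn; lra.
(* The even total is [(4 p - 2) / 3]; removing [(p + 1) / 2] for the class [p - 1] leaves
   [(5 p - 7) / 6]. *)
have even_sum : hsum p (eqm4^~ (p%:Z + 1)) = (5 * p%:R - 7) / 6.
  have := hsum_ell p (fun r => congr1 (eq_op^~ (oddz (p%:Z - 1))) (oddzN r)).
  rewrite hsum_parity class_sum (_ : p%:Z - 1 + 2 = p%:Z + 1); last by ring.
  have -> : sume p (fun r _ _ _ => oddz r == oddz (p%:Z - 1)) = 16 * (2 * p%:Z - 1).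
    rewrite -sume_even //; apply: eq_bigl => -[[[r a] b] c'].
    by rewrite (_ : oddz (p%:Z - 1) = false) ?eqbF_neg // /oddz; lia.
  by rewrite rmorphM rmorphB rmorphM /= -pmulrn; lra.
split; last split.
- case/orP => c4; first by rewrite (hsum_eqm p c4).
  by rewrite (hsum_eqm p c4) -hsum_opp.
- by move=> c4; rewrite (hsum_eqm p c4) PoszD.
- by move=> c4; rewrite (hsum_eqm p c4).
Qed.
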